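(* For any finite-dimensional $k$-algebra $A$, $\operatorname{rigdim}(A)\geq 2$.
   Context: $k$ is a field; algebras are finite-dimensional associative unital $k$-algebras, modules are finite-dimensional left modules. $\mathrm{D}=\operatorname{Hom}_k(-,k)$. An $A$-module $M$ is a generator-cogenerator if $A$ and $\mathrm{D}(A_A)$ lie in $\operatorname{add}(M)$ (direct summands of finite direct sums of copies of $M$). $\operatorname{domdim} E$ is the largest $t\in\mathbb{N}_0$, or $\infty$, such that in a minimal injective resolution $0\to {}_EE\to I^0\to I^1\to\cdots$ all $I^i$ with $0\leq i<t$ are projective. $\operatorname{rigdim}(A)=\sup\{\operatorname{domdim}\operatorname{End}_A(M)\mid M$ a generator-cogenerator in $A\text{-mod}$ with $\operatorname{gldim}\operatorname{End}_A(M)<\infty\}$. *)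

(* Defs.v *)
From HB Require Import structures.
From mathcomp Require Import all_boot all_order all_algebra.
From mathcomp Require Import all_classical constructive_ereal.

Set Implicit Arguments.
Unset Strict Implicit.
Unset Printing Implicit Defensive.

Import Order.TTheory GRing.Theory Num.Theory.

Local Open Scope classical_set_scope.
Local Open Scope ring_scope.

(* MathComp's [algType] and [falgType] require [1 != 0]. Here the zero algebra
   is allowed, since the endomorphism algebra of the zero module is zero: a
   [k]-algebra is a ring with a ring morphism from [k] to its center. *)
Record algebra (k : fieldType) := Algebra {
  alg_ring :> pzRingType;
  alg_map : {rmorphism k -> alg_ring};
  alg_mapC : forall (c : k) (a : alg_ring), GRing.comm (alg_map c) a
}.

Definition hom (R : pzRingType) (U V : lmodType R) : Type := {linear U -> V}.

Section HomZmodule.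
Variables (R : pzRingType) (U V : lmodType R).

HB.instance Definition _ := gen_eqMixin (hom U V).
HB.instance Definition _ := gen_choiceMixin (hom U V).

Lemma hom_ext (f g : hom U V) :
  (f : {linear U -> V}) =1 (g : {linear U -> V}) -> f = g.
Proof.
case: f => f [[hf1] [hf2]]; case: g => g [[hg1] [hg2]] /= /funext fg.
rewrite {}fg in hf1 hf2 *.
by rewrite (Prop_irrelevance hf1 hg1) (Prop_irrelevance hf2 hg2).
Qed.

Definition hom_zero : hom U V := (\0 : {linear U -> V}).
Definition hom_add (f g : hom U V) : hom U V :=
  ((f : {linear U -> V}) \+ (g : {linear U -> V}) : {linear U -> V}).
Definition hom_opp (f : hom U V) : hom U V :=
  (\- (f : {linear U -> V}) : {linear U -> V}).

Fact hom_addA : associative hom_add.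
Proof. by move=> f g h; apply: hom_ext => x /=; rewrite addrA. Qed.
Fact hom_addC : commutative hom_add.
Proof. by move=> f g; apply: hom_ext => x /=; rewrite addrC. Qed.
Fact hom_add0 : left_id hom_zero hom_add.
Proof. by move=> f; apply: hom_ext => x /=; rewrite add0r. Qed.
Fact hom_addN : left_inverse hom_zero hom_opp hom_add.
Proof. by move=> f; apply: hom_ext => x /=; rewrite addNr. Qed.

HB.instance Definition _ :=
  GRing.isZmodule.Build (hom U V) hom_addA hom_addC hom_add0 hom_addN.
End HomZmodule.

(* The product is composition, [(f * g) x = f (g x)], so that [M] is a left
   module over its endomorphism ring. *)
Definition endo (R : pzRingType) (M : lmodType R) : Type := hom M M.

Section EndoRing.
Variables (R : pzRingType) (M : lmodType R).

HB.instance Definition _ := GRing.Zmodule.on (endo M).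

Definition endo_one : endo M := (idfun : {linear M -> M}).
Definition endo_mul (f g : endo M) : endo M :=
  ((f : {linear M -> M}) \o (g : {linear M -> M}) : {linear M -> M}).

Fact endo_mulA : associative endo_mul.
Proof. by move=> f g h; apply: hom_ext. Qed.
Fact endo_mul1l : left_id endo_one endo_mul.
Proof. by move=> f; apply: hom_ext. Qed.
Fact endo_mul1r : right_id endo_one endo_mul.
Proof. by move=> f; apply: hom_ext. Qed.
Fact endo_mulDl : left_distributive endo_mul +%R.
Proof. by move=> f g h; apply: hom_ext. Qed.
Fact endo_mulDr : right_distributive endo_mul +%R.
Proof. by move=> f g h; apply: hom_ext => x; apply: (linearD (f : {linear _ -> _})). Qed.

HB.instance Definition _ := GRing.Zmodule_isPzRing.Build (endo M)
  endo_mulA endo_mul1l endo_mul1r endo_mulDl endo_mulDr.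
End EndoRing.

Section EndoAlgebra.
Variables (k : fieldType) (A : algebra k) (M : lmodType A).

Section Homothety.
Variable c : k.
Definition homothety_fun (x : M) : M := alg_map A c *: x.
Fact homothety_is_linear : linear homothety_fun.
Proof.
by move=> a x y; rewrite /homothety_fun scalerDr !scalerA (alg_mapC c a).
Qed.
HB.instance Definition _ :=
  GRing.isLinear.Build A M M _ homothety_fun homothety_is_linear.
End Homothety.

Definition homothety (c : k) : endo M := (homothety_fun c : {linear M -> M}).

Fact homothety_is_zmod_morphism : zmod_morphism homothety.
Proof.
move=> c d; apply: hom_ext => x /=.
by rewrite /homothety_fun rmorphB scalerBl.
Qed.
Fact homothety_is_monoid_morphism : monoid_morphism homothety.
Proof.
split=> [|c d]; apply: hom_ext => x /=; rewrite /homothety_fun.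
  by rewrite rmorph1 scale1r.
by rewrite rmorphM scalerA.
Qed.
HB.instance Definition _ :=
  GRing.isZmodMorphism.Build k (endo M) homothety homothety_is_zmod_morphism.
HB.instance Definition _ :=
  GRing.isMonoidMorphism.Build k (endo M) homothety homothety_is_monoid_morphism.

Fact homothety_comm (c : k) (f : endo M) : GRing.comm (homothety c) f.
Proof.
apply: hom_ext => x; apply/esym; exact: (linearZZ (f : {linear M -> M})).
Qed.

Definition End_alg : algebra k :=
  @Algebra k (endo M) homothety homothety_comm.
End EndoAlgebra.

Definition restrict (k : fieldType) (A : algebra k) (M : lmodType A) : Type := M.

Section Restrict.
Variables (k : fieldType) (A : algebra k) (M : lmodType A).

HB.instance Definition _ := GRing.Zmodule.on (restrict M).

Definition restrict_scale (c : k) (x : restrict M) : restrict M :=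
  alg_map A c *: (x : M).

Fact restrict_scaleA (a b : k) (v : restrict M) :
  restrict_scale a (restrict_scale b v) = restrict_scale (a * b) v.
Proof. by rewrite /restrict_scale scalerA rmorphM. Qed.
Fact restrict_scale1 : left_id 1 restrict_scale.
Proof. by move=> v; rewrite /restrict_scale rmorph1 scale1r. Qed.
Fact restrict_scaleDr : right_distributive restrict_scale +%R.
Proof. by move=> a u v; apply: scalerDr. Qed.
Fact restrict_scaleDl (v : restrict M) : {morph restrict_scale^~ v : a b / a + b}.
Proof. by move=> a b; rewrite /restrict_scale rmorphD scalerDl. Qed.

HB.instance Definition _ := GRing.Zmodule_isLmodule.Build k (restrict M)
  restrict_scaleA restrict_scale1 restrict_scaleDr restrict_scaleDl.
End Restrict.

(* The left [A]-module D(A_A) = Hom_k(A, k), with [(a *: f) x = f (x * a)]. *)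
Definition dual_regular (k : fieldType) (A : algebra k) : Type :=
  hom (restrict A^o) k^o.

Section DualRegular.
Variables (k : fieldType) (A : algebra k).

HB.instance Definition _ := GRing.Zmodule.on (dual_regular A).

Section Scale.
Variables (a : A) (f : {linear (restrict A^o) -> k^o}).
Definition dual_scale_fun (x : restrict A^o) : k^o :=
  f ((x : A) * a : A).
Fact dual_scale_is_linear : linear dual_scale_fun.
Proof.
move=> c x y; rewrite /dual_scale_fun -linearP; congr (f _).
by rewrite mulrDl; congr (_ + _); apply/esym/mulrA.
Qed.
HB.instance Definition _ := GRing.isLinear.Build k (restrict A^o)
  k^o _ dual_scale_fun dual_scale_is_linear.
End Scale.

Definition dual_scale (a : A) (f : dual_regular A) : dual_regular A :=
  (dual_scale_fun a f : {linear (restrict A^o) -> k^o}).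

Fact dual_scaleA (a b : A) (f : dual_regular A) :
  dual_scale a (dual_scale b f) = dual_scale (a * b) f.
Proof.
by apply: hom_ext => x /=; rewrite /dual_scale_fun /= /dual_scale_fun mulrA.
Qed.
Fact dual_scale1 : left_id 1 dual_scale.
Proof. by move=> f; apply: hom_ext => x /=; rewrite /dual_scale_fun mulr1. Qed.
Fact dual_scaleDr : right_distributive dual_scale +%R.
Proof. by move=> a f g; apply: hom_ext. Qed.
Fact dual_scaleDl (f : dual_regular A) : {morph dual_scale^~ f : a b / a + b}.
Proof.
move=> a b; apply: hom_ext => x /=; rewrite /dual_scale_fun mulrDr.
exact: (linearD (f : {linear _ -> _})).
Qed.

HB.instance Definition _ := GRing.Zmodule_isLmodule.Build A (dual_regular A)
  dual_scaleA dual_scale1 dual_scaleDr dual_scaleDl.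
End DualRegular.

Section Modules.
Variables (k : fieldType) (A : algebra k).
Implicit Types M X Y P : lmodType A.

Definition finite_dim M : Prop :=
  exists n : nat, inhabited (Vector.axiom n (restrict M)).

Definition module_iso X Y : Prop := exists f : {linear X -> Y}, bijective f.

Definition in_add M X : Prop :=
  exists (n : nat) (Y : lmodType A),
    module_iso (X * Y)%type {ffun 'I_n -> M}.

Definition generator_cogenerator M : Prop :=
  in_add M A^o /\ in_add M (dual_regular A).

(* Projectivity and injectivity are those of the category of
   finite-dimensional modules. *)
Definition projective_module P : Prop :=
  forall X Y, finite_dim X -> finite_dim Y ->
  forall (g : {linear X -> Y}) (f : {linear P -> Y}),
    range g = setT -> exists h : {linear P -> X}, g \o h =1 f.

Definition injective_module (I : lmodType A) : Prop :=
  forall X Y, finite_dim X -> finite_dim Y ->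
  forall (g : {linear X -> Y}) (f : {linear X -> I}),
    injective g -> exists h : {linear Y -> I}, h \o g =1 f.

Definition mod_ker X Y (f : {linear X -> Y}) : set X := f @^-1` [set 0].

Definition essential M (S : set M) : Prop :=
  forall T : {pred M}, submod_closed T ->
    S `&` [set` T] = [set 0] -> [set` T] = [set 0].

(* Minimality: [I 0] is an injective envelope of [X] and each [I i.+1] is an
   injective envelope of the image of [d i]. *)
Definition minimal_injective_resolution X (I : nat -> lmodType A)
    (e : {linear X -> I 0%N}) (d : forall i, {linear I i -> I i.+1}) : Prop :=
  [/\ forall i, finite_dim (I i) /\ injective_module (I i),
      injective e /\ range e = mod_ker (d 0%N),
      forall i, range (d i) = mod_ker (d i.+1)
    & essential (range e) /\ forall i, essential (range (d i))].

Definition projective_resolution X (P : nat -> lmodType A)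
    (e : {linear P 0%N -> X}) (d : forall i, {linear P i.+1 -> P i}) : Prop :=
  [/\ forall i, finite_dim (P i) /\ projective_module (P i),
      range e = setT /\ range (d 0%N) = mod_ker e
    & forall i, range (d i.+1) = mod_ker (d i)].

(* Dimensions are extended natural numbers, taken in [\bar int], where every
   set of such numbers has a supremum and an infimum; the first argument of
   [supremum] and [infimum] is the value at the empty set. *)
Definition proj_dim X : \bar int :=
  infimum +oo%E [set (n%:Z)%:E | n in [set n : nat |
    exists (P : nat -> lmodType A) (e : {linear P 0%N -> X})
           (d : forall i, {linear P i.+1 -> P i}),
      projective_resolution e d /\
      forall i, (n < i)%N -> forall x : P i, x = 0]].

Definition gldim : \bar int :=
  supremum 0%E [set r |
    exists X : lmodType A, finite_dim X /\ r = proj_dim X].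

Definition domdim : \bar int :=
  supremum 0%E [set (t%:Z)%:E | t in [set t : nat |
    exists (I : nat -> lmodType A) (e : {linear A^o -> I 0%N})
           (d : forall i, {linear I i -> I i.+1}),
      minimal_injective_resolution e d /\
      forall i, (i < t)%N -> projective_module (I i)]].

End Modules.

Definition rigdim (k : fieldType) (A : algebra k) : \bar int :=
  supremum 0%E [set r | exists M : lmodType A,
    [/\ finite_dim M, generator_cogenerator M,
        (gldim (End_alg M) < +oo)%E & r = domdim (End_alg M)]].

(* Main.v *)
(** Iyama's theorem on representation dimension, combined with the
    Morita-Tachikawa correspondence.

    For a nonzero module [M] with [E = End(M)], let [Z] be a simple
    [E]-submodule of [M], [m] its annihilator in [E] and
    [U = {x | m x = 0}], an [A]-submodule containing [Z].  A minimal idempotent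
    [e] with [e Z <> 0] has a local corner [e E e].  Either [1 - e] does not
    kill [Z], and then [M] is a retract of a power of the smaller module
    [(1 - e) M], or every map [M -> M / U] kills [U] and [E / m] is a division
    ring.  Iterating [M |-> M / U] from [A + D(A)] gives modules
    [M_0, M_1, ...] that eventually vanish; their sum [T] is a
    generator-cogenerator.

    Left [End(T)]-modules of the form [Hom(X, T)], with [X] in [add(T)], are
    projective.  By induction on [l], an [End(T)]-module on which the maps
    factoring through [M_l + M_{l+1} + ...] act as zero has bounded projective
    dimension, the standard modules being
    [Hom(M_l, T) / Hom(M_l / U_l, T)].  So [End(T)] has finite global
    dimension.

    Since [A] and [D(A)] lie in [add(T)], the [End(T)]-module [T] is projective
    and injective, and a presentation of [T] over [A] gives an exact sequence
    [0 -> End(T) -> T^n -> T^p].  The first two terms of the minimal injective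
    resolution of [End(T)] are summands of [T^n] and [T^p]. *)
From HB Require Import structures.
Require Import Defs.
From mathcomp Require Import all_boot all_order all_algebra.
From mathcomp Require Import all_classical constructive_ereal.
From mathcomp Require Import zify.

Set Implicit Arguments.
Unset Strict Implicit.
Unset Printing Implicit Defensive.

(* [restrict] also exists in mathcomp-classical. *)
Import Defs.
Import Order.TTheory GRing.Theory Num.Theory.

Local Open Scope classical_set_scope.
Local Open Scope ring_scope.

(** * Submodules and quotient modules *)

Section Generic.
Variable R : pzRingType.
Implicit Types M N X Y Z : lmodType R.

Definition lin_of X Y (f : X -> Y) (f_lin : linear f) : {linear X -> Y} :=
  HB.pack f (GRing.isLinear.Build R X Y _ f f_lin).

(** Membership is a [Prop], so kernels, images and annihilators qualify directly; [submodule_pred]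
    makes it boolean, classically, for the type [sub]. *)
Record submodule M := Submodule {
  submodule_set :> M -> Prop;
  submodule0 : submodule_set 0;
  submoduleP : forall a x y,
    submodule_set x -> submodule_set y -> submodule_set (a *: x + y)
}.

Section Submodule.
Variables (M : lmodType R) (S : submodule M).

Lemma submoduleD x y : S x -> S y -> S (x + y).
Proof. by move=> Sx Sy; rewrite -[x]scale1r; apply: submoduleP. Qed.

Lemma submoduleZ a x : S x -> S (a *: x).
Proof. by move=> Sx; rewrite -[_ *: _]addr0; apply/submoduleP/submodule0. Qed.

Lemma submoduleB x y : S x -> S y -> S (x - y).
Proof.
by move=> Sx Sy; apply: submoduleD => //; rewrite -scaleN1r; apply: submoduleZ.
Qed.

Lemma submodule_subC x y : S (x - y) -> S (y - x).
Proof. by move=> Sxy; rewrite -[y - x]opprB -sub0r;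
  apply/submoduleB/Sxy/submodule0. Qed.

Definition submodule_pred : {pred M} := fun x => `[< S x >].

Lemma submodule_predP x : reflect (S x) (x \in submodule_pred).
Proof. exact: asboolP. Qed.

Fact submodule_pred_closed : submod_closed submodule_pred.
Proof.
split=> [|a x y /submodule_predP Sx /submodule_predP Sy].
  exact/submodule_predP/submodule0.
exact/submodule_predP/submoduleP.
Qed.

HB.instance Definition _ :=
  GRing.isSubmodClosed.Build R M submodule_pred submodule_pred_closed.

Definition sub : Type := {x : M | x \in submodule_pred}.
HB.instance Definition _ := SubType.on sub.
HB.instance Definition _ := [Choice of sub by <:].
HB.instance Definition _ := [SubChoice_isSubLmodule of sub by <:].

Definition subval : {linear sub -> M} := val.

Lemma subval_inj : injective subval.
Proof. exact: val_inj. Qed.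

Lemma subvalP (x : sub) : S (subval x).
Proof. exact/submodule_predP/(valP x). Qed.

Definition insub_mod (x : M) (Sx : S x) : sub :=
  Sub x (introT (submodule_predP x) Sx).

Lemma insub_modK x (Sx : S x) : subval (insub_mod Sx) = x.
Proof. exact: SubK. Qed.

Section Corestrict.
Variables (X : lmodType R) (f : {linear X -> M}) (fS : forall x, S (f x)).

Fact corestrict_linear : linear (fun x => insub_mod (fS x)).
Proof. by move=> a x y; apply: subval_inj;
  rewrite [RHS]linearP !insub_modK linearP. Qed.

Definition corestrict : {linear X -> sub} := lin_of corestrict_linear.

Lemma corestrictE x : subval (corestrict x) = f x.
Proof. exact: insub_modK. Qed.
End Corestrict.

(* The quotient by [S] is carried by chosen coset representatives; every coset
   is nonempty, so the default value [0] of [xget] is never used. *)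
Definition coset_repr (x : M) : M := xget 0 [set y | S (x - y)].

Lemma coset_reprP x : S (x - coset_repr x).
Proof.
rewrite /coset_repr; case: xgetP => [y _ //|/(_ x)/=[]].
by rewrite subrr; apply: submodule0.
Qed.

Lemma eq_coset_repr x y : S (x - y) -> coset_repr x = coset_repr y.
Proof.
move=> Sxy; rewrite /coset_repr; congr (xget _ _).
apply/seteqP; split=> z /= Sz.
  by rewrite -(subrKA x y (- z)); apply: submoduleD => //;
    apply: submodule_subC.
by rewrite -(subrKA y x (- z)); apply: submoduleD.
Qed.

Definition quot : Type := {x : M | coset_repr x == x}.
HB.instance Definition _ := SubType.on quot.
HB.instance Definition _ := [Choice of quot by <:].

Definition quot_pi (x : M) : quot :=
  exist _ (coset_repr x) (introT eqP (eq_coset_repr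
    (submodule_subC (coset_reprP x)))).

Lemma quot_piP x y : quot_pi x = quot_pi y <-> S (x - y).
Proof.
split=> [[xy]|Sxy]; last by apply: val_inj; apply: eq_coset_repr.
rewrite -(subrKA (coset_repr x)) {2}xy.
by apply: submoduleD; [|apply: submodule_subC]; apply: coset_reprP.
Qed.

Lemma quot_piK (x : quot) : quot_pi (val x) = x.
Proof. by apply: val_inj => /=; apply/eqP; apply: (valP x). Qed.

Lemma quot_val x : S (val (quot_pi x) - x).
Proof. exact/submodule_subC/coset_reprP. Qed.

Definition quot_add (x y : quot) : quot := quot_pi (val x + val y).
Definition quot_opp (x : quot) : quot := quot_pi (- val x).
Definition quot_scale (a : R) (x : quot) : quot := quot_pi (a *: val x).

Lemma quot_addE x y : quot_add (quot_pi x) (quot_pi y) = quot_pi (x + y).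
Proof. by apply/quot_piP; rewrite opprD addrACA; apply: submoduleD;
  apply: quot_val. Qed.

Lemma quot_scaleE a x : quot_scale a (quot_pi x) = quot_pi (a *: x).
Proof. by apply/quot_piP; rewrite -scalerBr; apply/submoduleZ/quot_val. Qed.

Fact quot_addA : associative quot_add.
Proof.
move=> x y z; rewrite -(quot_piK x) -(quot_piK y) -(quot_piK z).
by rewrite !quot_addE addrA.
Qed.
Fact quot_addC : commutative quot_add.
Proof. by move=> x y; rewrite /quot_add addrC. Qed.
Fact quot_add0 : left_id (quot_pi 0) quot_add.
Proof. by move=> x; rewrite -(quot_piK x) quot_addE add0r. Qed.
Fact quot_addN : left_inverse (quot_pi 0) quot_opp quot_add.
Proof. by move=> x; rewrite -{2}(quot_piK x) quot_addE addNr. Qed.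
HB.instance Definition _ :=
  GRing.isZmodule.Build quot quot_addA quot_addC quot_add0 quot_addN.

Fact quot_scaleA (a b : R) (x : quot) :
  quot_scale a (quot_scale b x) = quot_scale (a * b) x.
Proof. by rewrite -(quot_piK x) !quot_scaleE scalerA. Qed.
Fact quot_scale1 : left_id 1 quot_scale.
Proof. by move=> x; rewrite -(quot_piK x) quot_scaleE scale1r. Qed.
Fact quot_scaleDr : right_distributive quot_scale +%R.
Proof.
move=> a x y; rewrite -(quot_piK x) -(quot_piK y) /GRing.add /=.
by rewrite !(quot_addE, quot_scaleE) scalerDr.
Qed.
Fact quot_scaleDl (x : quot) : {morph quot_scale^~ x : a b / a + b}.
Proof.
move=> a b; rewrite -(quot_piK x) /= !quot_scaleE scalerDl.
by rewrite {2}/GRing.add /= quot_addE.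
Qed.
HB.instance Definition _ := GRing.Zmodule_isLmodule.Build R quot
  quot_scaleA quot_scale1 quot_scaleDr quot_scaleDl.

Fact quot_pi_linear : linear quot_pi.
Proof. by move=> a x y; rewrite -quot_addE -quot_scaleE. Qed.
Definition quot_proj : {linear M -> quot} := lin_of quot_pi_linear.

Lemma quot_projK (y : quot) : quot_proj (val y) = y.
Proof. exact: quot_piK. Qed.

Lemma quot_proj_eq0 x : quot_proj x = 0 <-> S x.
Proof. by rewrite -{2}[x]subr0; apply: quot_piP. Qed.

Lemma quot_proj_surj y : exists x, quot_proj x = y.
Proof. by exists (val y); apply: quot_projK. Qed.

Section Factor.
Variables (X : lmodType R) (f : {linear M -> X})
  (fS : forall x, S x -> f x = 0).

Let quot_lift_key x y : quot_proj x = quot_proj y -> f x = f y.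
Proof. by move=> /quot_piP/fS/eqP; rewrite linearB subr_eq0 => /eqP. Qed.

Fact quot_lift_linear : linear (fun y : quot => f (val y)).
Proof.
move=> a x y; rewrite -linearP; apply: quot_lift_key.
by rewrite [RHS]linearP !quot_projK.
Qed.
Definition quot_lift : {linear quot -> X} := lin_of quot_lift_linear.
Lemma quot_liftE x : quot_lift (quot_proj x) = f x.
Proof. by apply: quot_lift_key; rewrite quot_projK. Qed.
End Factor.

End Submodule.

Definition lin_ker X Y (f : {linear X -> Y}) : submodule X.
Proof.
exists (fun x => f x = 0); first exact: linear0.
by move=> a x y fx fy; rewrite linearP fx fy scaler0 addr0.
Defined.

Definition lin_im X Y (f : {linear X -> Y}) : submodule Y.
Proof.
exists (fun y => exists x, f x = y); first by exists 0; apply: linear0.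
by move=> a _ _ [x <-] [y <-]; exists (a *: x + y); apply: linearP.
Defined.

End Generic.

(** * Finite-dimensional vector spaces *)

Lemma ex_minimal (P : nat -> Prop) :
  (exists n, P n) -> exists n, P n /\ forall m, P m -> (n <= m)%N.
Proof.
case=> n; have [m] := ubnP n; elim: m n => // m IHm n /ltnSE lenm Pn.
have [[p [ltpn Pp]]|min_n] := pselect (exists p, (p < n)%N /\ P p).
  by apply: (IHm p) => //; apply: leq_trans lenm.
exists n; split=> // p Pp; rewrite leqNgt; apply/negP => ltpn.
by apply: min_n; exists p.
Qed.

Lemma inj_surj_bij (T U : Type) (f : T -> U) :
  injective f -> (forall u, exists t, f t = u) -> bijective f.
Proof.
move=> f_inj f_surj; exists (fun u => sval (cid (f_surj u))) => [t|u].
  by apply: f_inj; case: cid.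
by case: cid.
Qed.

Section VectorSpaces.
Variable k : fieldType.
Implicit Types U V W : lmodType k.

Definition has_dim n V : Prop := inhabited (Vector.axiom n V).

(** A subspace of maximal dimension inside [S] is all of [S], because a further vector of [S] would
    enlarge it. The index of [P] is a codimension, which turns the maximum into a minimum. *)
Lemma row_subspace n (S : submodule 'rV[k]_n) :
  exists U : {vspace 'rV[k]_n}, forall v, S v <-> v \in U.
Proof.
pose P m := exists U : {vspace 'rV[k]_n},
  (forall v, v \in U -> S v) /\ (\dim U = n - m)%N.
have [|m [[U [US dimU]] min_m]] := ex_minimal (P := P).
  exists n, 0%VS; rewrite dimv0 subnn; split=> // v; rewrite memv0 => /eqP ->.
  exact: submodule0.
exists U => v; split=> [Sv|/US//]; apply/negPn/negP => vU.
have dimUv : (\dim U < \dim (U + <[v]>))%N.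
  rewrite ltnNge; apply: contra vU => dimUv.
  have /eqP -> : U == (U + <[v]>)%VS by rewrite eqEdim addvSl.
  by apply: (subvP (addvSr _ _)); apply: memv_line.
have le_n : (\dim (U + <[v]>) <= n)%N.
  by rewrite (leq_trans (dimvS (subvf _)))// dimvf /dim /= mul1n.
have /min_m : P (n - \dim (U + <[v]>))%N.
  exists (U + <[v]>)%VS; rewrite subKn//;
    split=> // w /memv_addP[u uU [_ /vlineP[c ->] ->]].
  by apply: submoduleD; [apply: US|apply: submoduleZ].
by move: dimUv le_n; rewrite dimU; lia.
Qed.

Lemma has_dimP n V : has_dim n V <->
  exists (f : {linear V -> 'rV[k]_n}) (g : {linear 'rV[k]_n -> V}),
    cancel f g /\ cancel g f.
Proof.
split=> [[[f f_lin [g fK gK]]]|[f [g [fK gK]]]]; last first.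
  by constructor; exists f; [apply: linearP|exists g].
have g_lin : linear g by move=> a x y; apply: (canLR fK); rewrite f_lin !gK.
by exists (lin_of f_lin), (lin_of g_lin).
Qed.

(** The last clause turns properness into strict decrease of dimension, which drives the later
    inductions. *)
Lemma has_dim_inj V W (f : {linear V -> W}) n :
  injective f -> has_dim n W ->
  exists m, [/\ has_dim m V, (m <= n)%N & m = n -> forall w, exists v, f v = w].
Proof.
move=> f_inj /has_dimP[g [h [gK hK]]].
have [U UP] := row_subspace (lin_im (g \o f)).
have fU v : g (f v) \in U by apply/UP; exists v.
have [s2r s2r_lin s2r_bij] := subvs_vect_iso U.
exists (\dim U); split.
- constructor; exists (fun v => s2r (vsproj U (g (f v)))).
    by move=> a x y; rewrite -s2r_lin !linearP.
  apply: inj_surj_bij => [x y /(bij_inj s2r_bij)|r].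
    by move=> /(congr1 vsval); rewrite !vsprojK// => /(can_inj gK)/f_inj.
  have [r2s s2rK r2sK] := s2r_bij.
  have /UP[v /= vE] := subvsP (r2s r).
  by exists v; rewrite vE vsvalK r2sK.
- by rewrite (leq_trans (dimvS (subvf _)))// dimvf /dim /= mul1n.
move=> dimU w; have /eqP UT : U == fullv.
  by rewrite eqEdim subvf dimvf /dim /= mul1n dimU.
have /UP[v /= vE] : g w \in U by rewrite UT memvf.
by exists v; apply: (can_inj gK).
Qed.

(** [r] projects onto the image of [f] and takes the preimage there. *)
Lemma linear_retraction V W (f : {linear V -> W}) n :
  injective f -> has_dim n W -> exists r : {linear W -> V}, cancel f r.
Proof.
move=> f_inj /has_dimP[g [h [gK hK]]].
have [U UP] := row_subspace (lin_im (g \o f)).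
have rP w : exists v, g (f v) = projv U (g w) by apply/UP/memv_proj.
have gf_inj : injective (g \o f) by apply: inj_comp => //; apply: can_inj gK.
have [r rE] := choice rP.
have r_lin : linear r.
  by move=> a x y; apply: gf_inj; rewrite [RHS]linearP /= !rE !linearP.
exists (lin_of r_lin) => v; apply: gf_inj; rewrite /= rE projv_id//.
by apply/UP; exists v.
Qed.

Lemma linear_section V W (f : {linear V -> W}) n :
  (forall w, exists v, f v = w) -> has_dim n V ->
  exists s : {linear W -> V}, cancel s f.
Proof.
move=> f_surj /has_dimP[v2r [r2v [v2rK r2vK]]].
have [g gE] : exists g : {linear 'rV_n -> W}, forall r, g r = f (r2v r).
  by exists (f \o r2v).
have [U UP] := row_subspace (lin_ker g).
have g_surj w : exists r, g r = w.
  by have [v <-] := f_surj w; exists (v2r v); rewrite gE v2rK.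
(* [q r] is the component of [r] complementary to the kernel [U]. It depends only on [g r], so
   applying [q] to arbitrarily chosen preimages [t] gives a linear map. *)
pose q r := r - projv U r.
have q_key x y : g x = g y -> q x = q y.
  move=> gxy; have xyU : x - y \in U by apply/UP;
    rewrite /= linearB /= gxy subrr.
  apply/eqP; rewrite -subr_eq0 /q opprD addrACA -opprD -(linearB (projv U))
    subr_eq0.
  by apply/eqP/esym/projv_id.
have gq r : g (q r) = g r.
  by rewrite linearB; have /UP/= -> := memv_proj U r; rewrite subr0.
have [t tK] := choice g_surj.
have s_lin : linear (fun w => r2v (q (t w))).
  move=> a x y; rewrite -linearP; congr (r2v _).
  transitivity (q (a *: t x + t y)); first by apply: q_key; rewrite linearP !tK.
  by rewrite /q linearP scalerBr opprD addrACA.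
by exists (lin_of s_lin) => w; rewrite /= -gE gq tK.
Qed.

Lemma has_dim_surj V W (f : {linear V -> W}) n :
  (forall w, exists v, f v = w) -> has_dim n V ->
  exists m, [/\ has_dim m W, (m <= n)%N & m = n -> injective f].
Proof.
move=> f_surj dimV; have [s sK] := linear_section f_surj dimV.
have [m [dimW lemn s_surj]] := has_dim_inj (can_inj sK) dimV.
exists m; split=> // /s_surj{}s_surj x y.
by have [[x' <-] [y' <-]] := (s_surj x, s_surj y); rewrite !sK => ->.
Qed.

Lemma has_dim_row n : has_dim n 'rV[k]_n.
Proof. by constructor; exists id => //; exists id. Qed.

Lemma has_dim_prod V W m n :
  has_dim m V -> has_dim n W -> exists p, has_dim p (V * W)%type.
Proof.
move=> /has_dimP[f [f' [fK _]]] /has_dimP[g [g' [gK _]]].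
have h_lin : linear (fun x : V * W => row_mx (f x.1) (g x.2)).
  by move=> a x y; rewrite !linearP scale_row_mx add_row_mx.
have h_inj : injective (lin_of h_lin).
  by move=> [x x'] [y y'] /= /eq_row_mx[/(can_inj fK) -> /(can_inj gK) ->].
by have [p [? _ _]] := has_dim_inj h_inj (has_dim_row _); exists p.
Qed.

Lemma has_dim_ffun (I : finType) V n :
  has_dim n V -> exists p, has_dim p {ffun I -> V}.
Proof.
move=> /has_dimP[f [f' [fK _]]].
have h_lin : linear (fun x : {ffun I -> V} =>
    mxvec (\matrix_(i < #|I|) f (x (enum_val i)))).
  move=> a x y; rewrite -linearP; congr mxvec; apply/row_matrixP => i.
  by rewrite linearP /= !rowK !ffunE linearP.
have h_inj : injective (lin_of h_lin).
  move=> x y /= /(can_inj mxvecK)/row_matrixP xy; apply/ffunP => i.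
  by have := xy (enum_rank i); rewrite !rowK enum_rankK => /(can_inj fK).
by have [p [? _ _]] := has_dim_inj h_inj (has_dim_row _); exists p.
Qed.

Lemma has_dim_basis V n : has_dim n V ->
  exists (c : 'I_n -> {linear V -> k^o}) (u : 'I_n -> V),
    (forall v, v = \sum_i c i v *: u i) /\
    (forall (w : 'I_n -> k) i, c i (\sum_j w j *: u j) = w i).
Proof.
move=> /has_dimP[f [g [fK gK]]].
have c_lin i : linear (fun v => f v 0 i : k^o).
  by move=> a x y; rewrite linearP !mxE.
have gE (w : 'I_n -> k) : \sum_j w j *: g (delta_mx 0 j) = g (\row_j w j).
  rewrite [\row_j _]row_sum_delta linear_sum.
  by apply: eq_bigr => i _; rewrite linearZ mxE.
exists (fun i => lin_of (c_lin i)), (fun i => g (delta_mx 0 i));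
  split=> [v|w i].
  by rewrite gE; apply: (can_inj fK); rewrite gK; apply/rowP => i; rewrite mxE.
by rewrite gE /= gK mxE.
Qed.

Lemma linear_dependence V n (u : 'I_n.+1 -> V) : has_dim n V ->
  exists2 c : 'I_n.+1 -> k, \sum_i c i *: u i = 0 & exists i, c i != 0.
Proof.
move=> /has_dimP[f [g [fK _]]]; pose C := \matrix_i f (u i).
have : (0 < \rank (kermx C))%N by rewrite mxrank_ker subn_gt0 ltnS rank_leq_col.
rewrite lt0n mxrank_eq0 => /rowV0Pn[c /sub_kermxP cC c0].
exists (fun i => c 0 i); last exact/rV0Pn.
apply: (can_inj fK); rewrite linear0 linear_sum -[RHS]cC mulmx_sum_row.
by apply: eq_bigr => i _; rewrite linearZ rowK.
Qed.

End VectorSpaces.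

(** * Finite-dimensional modules *)

Section Modules.
Variables (k : fieldType) (A : algebra k).
Implicit Types M X Y Z : lmodType A.

Fact restrict_linear X Y (f : {linear X -> Y}) :
  linear (f : restrict X -> restrict Y).
Proof. by move=> c x y; rewrite linearD; congr (_ + _);
  exact: (linearZZ f (alg_map A c) x). Qed.

Definition restrict_lin X Y (f : {linear X -> Y}) :
  {linear restrict X -> restrict Y} := lin_of (restrict_linear f).

Notation dim n M := (has_dim n (restrict M)).

Lemma dim_inj X Y (f : {linear X -> Y}) n :
  injective f -> dim n Y ->
  exists m, [/\ dim m X, (m <= n)%N & m = n -> forall y, exists x, f x = y].
Proof. by move=> f_inj; apply: (has_dim_inj (f := restrict_lin f)). Qed.

Lemma dim_surj X Y (f : {linear X -> Y}) n :
  (forall y, exists x, f x = y) -> dim n X ->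
  exists m, [/\ dim m Y, (m <= n)%N & m = n -> injective f].
Proof. by move=> f_surj; apply: (has_dim_surj (f := restrict_lin f)). Qed.

Lemma dim_sub M (S : submodule M) n : dim n M ->
  exists m, [/\ dim m (sub S), (m <= n)%N & m = n -> forall x, S x].
Proof.
move=> /(dim_inj (@subval_inj _ _ S))[m [? ? surj]]; exists m;
  split=> // /surj{}surj x.
by have [y <-] := surj x; apply: subvalP.
Qed.

Lemma dim_quot M (S : submodule M) n : dim n M ->
  exists m, [/\ dim m (quot S), (m <= n)%N & m = n -> forall x, S x -> x = 0].
Proof.
move=> /(dim_surj (@quot_proj_surj _ _ S))[m [? ? inj]]; exists m;
  split=> // /inj{}inj x Sx.
by apply: inj; rewrite linear0; apply/quot_proj_eq0.
Qed.

Lemma finite_dim_inj X Y (f : {linear X -> Y}) :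
  injective f -> finite_dim Y -> finite_dim X.
Proof. by move=> f_inj [n /(dim_inj f_inj)[m [? _ _]]]; exists m. Qed.

Lemma finite_dim_surj X Y (f : {linear X -> Y}) :
  (forall y, exists x, f x = y) -> finite_dim X -> finite_dim Y.
Proof. by move=> f_surj [n /(dim_surj f_surj)[m [? _ _]]]; exists m. Qed.

Lemma finite_dim_sub M (S : submodule M) : finite_dim M -> finite_dim (sub S).
Proof. exact/finite_dim_inj/subval_inj. Qed.

Lemma finite_dim_quot M (S : submodule M) : finite_dim M -> finite_dim (quot S).
Proof. exact/finite_dim_surj/quot_proj_surj. Qed.

Lemma finite_dim_prod X Y :
  finite_dim X -> finite_dim Y -> finite_dim (X * Y)%type.
Proof.
move=> [m dimX] [n dimY]; have [p dimXY] := has_dim_prod dimX dimY.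
have f_lin : linear (id : restrict (X * Y)%type -> restrict X * restrict Y)
  by [].
by have [q [? _ _]] := has_dim_inj (f := lin_of f_lin) (fun _ _ => id) dimXY;
  exists q.
Qed.

Lemma finite_dim_ffun (I : finType) X :
  finite_dim X -> finite_dim {ffun I -> X}.
Proof.
move=> [n dimX]; have [p dimIX] := has_dim_ffun I dimX.
have f_lin : linear (id : restrict {ffun I -> X} -> {ffun I -> restrict X}).
  by move=> c x y; apply/ffunP => i; rewrite !ffunE.
by have [q [? _ _]] := has_dim_inj (f := lin_of f_lin) (fun _ _ => id) dimIX;
  exists q.
Qed.

(** A submodule of least dimension with [P] is minimal, since an inclusion between submodules of
    equal dimension is onto. *)
Lemma minimal_submodule M (P : submodule M -> Prop) :
  finite_dim M -> (exists S, P S) ->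
  exists S, P S /\ forall S', P S' -> (forall x, S' x -> S x) ->
    forall x, S x -> S' x.
Proof.
move=> [n dimM] [S PS].
have [|m [[T [PT dimT]] min_m]] :=
    ex_minimal (P := fun m => exists S, P S /\ dim m (sub S)).
  by have [m [dimS _ _]] := dim_sub S dimM; exists m, S.
exists T; split=> // S' PS' S'T x Tx.
pose f := corestrict (fun y => S'T _ (subvalP y)).
have f_inj : injective f.
  by move=> y z /(congr1 (@subval _ _ T)); rewrite !corestrictE => /subval_inj.
have [p [dimS' lepm f_surj]] := dim_inj f_inj dimT.
have /f_surj{}f_surj : p = m by apply/eqP; rewrite eqn_leq lepm min_m//;
  exists S'.
have [y /(congr1 (@subval _ _ T))] := f_surj (insub_mod Tx).
by rewrite corestrictE insub_modK => <-; apply: subvalP.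
Qed.

(** The powers [1, f, ..., f^n] are linearly dependent. Dividing by the lowest nonzero coefficient
    expresses its power of [f] as the next power times a polynomial [w] in [f]. *)
Lemma strongly_pi_regular (Afd : finite_dim A^o) (f : A) :
  exists N w, GRing.comm f w /\ f ^+ N = f ^+ N.+1 * w.
Proof.
case: Afd => n dimA; have [c c0 [i ci]] :=
    linear_dependence (V := restrict A^o) (fun i => f ^+ i) dimA.
have [j [cj jmin]] : exists j, c j != 0 /\ forall i : 'I_n.+1, (i < j)%N ->
  c i = 0.
  case: (arg_minnP (P := fun i => c i != 0) val ci) => j cj jmin.
  exists j; split=> // l ltlj; apply/eqP/negPn/negP => /jmin/=.
  by rewrite leqNgt ltlj.
have {}c0 : \sum_i alg_map A (c i) * f ^+ i = 0 := c0.
exists j, (\sum_(i < n.+1 | (j < i)%N) alg_map A (- (c i / c j)) * f ^+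
  (i - j.+1)).
split.
  apply: commr_sum => l _; apply: commrM; last exact/commrX.
  exact/commr_sym/alg_mapC.
rewrite mulr_sumr; transitivity (\sum_(i < n.+1 | (j < i)%N) alg_map A
  (- (c i / c j)) * f ^+ i); last first.
  apply: eq_bigr => l ltjl; rewrite mulrA -[_ * alg_map A _](alg_mapC) -mulrA
    -exprD.
  by rewrite subnKC.
have /(congr1 (fun x => alg_map A (c j)^-1 * x)) := c0.
rewrite mulr0 (bigID (fun i : 'I_n.+1 => j < i)%N) /= addrC (bigD1 j) ?ltnn//=.
rewrite big1 ?addr0 => [|l /andP[]]; last first.
  rewrite -leqNgt leq_eqVlt -val_eqE => /orP[->//|/jmin -> _].
  by rewrite rmorph0 mul0r.
rewrite mulrDr mulrA -rmorphM mulVf// rmorph1 mul1r => /eqP.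
rewrite addr_eq0 => /eqP ->; rewrite mulr_sumr -sumrN; apply: eq_bigr => l _.
by rewrite mulrA -rmorphM mulrC rmorphN mulNr mulrC.
Qed.

(* [f^(N+1) u] is the idempotent projecting onto the part where [f] is
   invertible, along the part where [f] is nilpotent. *)
Lemma fitting (Afd : finite_dim A^o) (f : A) : exists N u,
  [/\ GRing.comm f u, f ^+ N.+1 * (f ^+ N.+1 * u) = f ^+ N.+1
    & (f ^+ N.+1 * u) * (f ^+ N.+1 * u) = f ^+ N.+1 * u].
Proof.
have [N [w [fw fN]]] := strongly_pi_regular Afd f.
have step j : f ^+ N.+1 = f ^+ (N.+1 + j) * w ^+ j.
  elim: j => [|j IHj]; first by rewrite addn0 mulr1.
  have fNj : f ^+ (N.+1 + j) = f ^+ (N.+1 + j.+1) * w.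
    by rewrite addSnnS addnC exprD fN mulrA -exprD addnC !addSn addnS.
  by rewrite {}IHj {1}fNj -mulrA -exprS.
exists N, (w ^+ N.+1).
have fu : f ^+ N.+1 * (f ^+ N.+1 * w ^+ N.+1) = f ^+ N.+1.
  by rewrite mulrA -exprD -step.
split=> //; first exact/commrX.
have fwN : GRing.comm (w ^+ N.+1) (f ^+ N.+1 * w ^+ N.+1).
  by apply: commrM; [apply/commrX/commr_sym/commrX|apply: commr_refl].
by rewrite -mulrA fwN mulrA fu.
Qed.
End Modules.

(** * Local corners of endomorphism algebras *)

Section Corner.
Variables (k : fieldType) (E : algebra k) (Efd : finite_dim E^o).
Variables (V : lmodType E) (Z : submodule V).
Hypothesis Z_simple :
  forall z z', Z z -> z <> 0 -> Z z' -> exists a : E, z' = a *: z.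
Variable e : E.
Hypothesis ee : e * e = e.
Hypothesis eZ : exists z, Z z /\ e *: z <> 0.
(* [e] is minimal among the idempotents that do not annihilate [Z]; hence every
   element of [e E e] is nilpotent, and then annihilates [Z], or invertible. *)
Hypothesis e_min : forall g : E, g * g = g -> e * g = g -> g * e = g ->
  (exists z, Z z /\ g *: z <> 0) -> g = e.

Definition annihilates (f : E) : Prop := forall z, Z z -> f *: z = 0.

Lemma annihilatesD f g : annihilates f -> annihilates g -> annihilates (f + g).
Proof. by move=> f0 g0 z Zz; rewrite scalerDl f0// g0// addr0. Qed.

Lemma annihilatesMl f g : annihilates f -> annihilates (g * f).
Proof. by move=> f0 z Zz; rewrite -scalerA f0// scaler0. Qed.

Lemma annihilatesMr f g : annihilates f -> annihilates (f * g).
Proof. by move=> f0 z Zz; rewrite -scalerA f0//; apply: submoduleZ. Qed.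

(** Membership in the ring [e E e], whose unit is [e]. *)
Definition corner (f : E) : Prop := e * f = f /\ f * e = f.

Lemma corner_mul f : corner (e * f * e).
Proof. by split; rewrite ?mulrA ?ee// -!mulrA ee. Qed.

Definition nilpotent (f : E) : Prop := exists n, f ^+ n = 0.

Lemma not_annihilates_e : ~ annihilates e.
Proof. by case: eZ => z [Zz ez0] /(_ z Zz). Qed.

Lemma nilpotent_fix f (x : V) : nilpotent f -> f *: x = x -> x = 0.
Proof.
move=> [n fn] fx; have fXx m : f ^+ m *: x = x.
  by elim: m => [|m IHm]; rewrite ?scale1r// exprS -scalerA IHm.
by rewrite -(fXx n) fn scale0r.
Qed.

(** The Fitting idempotent [p] of [f] lies in the corner. If [p] does not annihilate [Z], minimality
    gives [p = e], and [f] is invertible; otherwise [e - p] does not annihilate [Z], so [e - p = e]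
    and [f] is nilpotent. *)
Lemma corner_nilpotent_or_unit f : corner f ->
  nilpotent f \/ exists g, [/\ corner g, g * f = e & f * g = e].
Proof.
move=> [ef fe]; have [N [u [fu fp pp]]] := fitting Efd f.
set p := f ^+ N.+1 * u in fp pp.
have pE : p = u * f ^+ N.+1 by apply/commr_sym/commrX/commr_sym.
have ep : e * p = p by rewrite /p exprS !mulrA ef.
have pe : p * e = p by rewrite pE exprSr -!mulrA fe.
have [pZ|pZ] := pselect (exists z, Z z /\ p *: z <> 0).
  right; have p_e := e_min pp ep pe pZ.
  exists (e * (f ^+ N * u) * e); split; first exact: corner_mul.
    by rewrite -!mulrA ef -fu [f ^+ N * _]mulrA -exprSr -/p p_e ee.
  by rewrite !mulrA fe -exprS -/p pe.
left; exists N.+1; suff p0 : p = 0 by rewrite -fp p0 mulr0.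
have : e - p = e.
  apply: e_min; rewrite ?mulrBl ?mulrBr ?ee ?ep ?pe ?pp ?subrr ?subr0//.
  have [z [Zz ez0]] := eZ; exists z; split=> //.
  rewrite scalerBl [p *: z](_ : _ = 0) ?subr0//.
  by apply: contrapT => pz; apply: pZ; exists z.
by move/eqP; rewrite subr_eq addrC -subr_eq subrr eq_sym => /eqP.
Qed.

(** From [g f = e] follows [g^n f^n e = e] for all [n], so nilpotence of either factor would give
    [e = 0]. *)
Lemma nilpotent_not_unit f g : corner f -> nilpotent f \/ nilpotent g ->
  g * f <> e.
Proof.
move=> [ef fe] nil_fg gf; have gfn n : g ^+ n * (f ^+ n * e) = e.
  have fne m : e * (f ^+ m * e) = f ^+ m * e.
    have efm : e * f ^+ m = f ^+ m * e by apply: commrX;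
      rewrite /GRing.comm ef fe.
    by rewrite mulrA efm -mulrA ee.
  elim: n => [|n IHn]; first by rewrite !mul1r.
  by rewrite exprSr exprS -!mulrA [g * _]mulrA gf fne.
apply: not_annihilates_e; case: nil_fg => -[n n0]; rewrite -(gfn n) n0.
  by move=> z _; rewrite mul0r mulr0 scale0r.
by move=> z _; rewrite mul0r scale0r.
Qed.

(** If [f z <> 0], simplicity gives [z = a f z], so [e a f e] fixes [e z], which is nonzero. This
    element is then not nilpotent, hence a unit of the corner, and [f] has a left inverse there,
    against nilpotence. *)
Lemma corner_annihilates f : corner f -> nilpotent f -> annihilates f.
Proof.
move=> cf nil_f z Zz; apply: contrapT => fz0; have [ef fe] := cf.
have fez : f *: (e *: z) = f *: z by rewrite scalerA fe.
have [a zE] := Z_simple (submoduleZ f Zz) fz0 Zz.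
have [nil_af|[g [_ gaf _]]] := corner_nilpotent_or_unit (corner_mul (a * f)).
  apply: fz0; rewrite -fez (nilpotent_fix nil_af (x := e *: z)) ?scaler0//.
  by rewrite -!scalerA [e *: (e *: z)]scalerA ee fez -zE.
apply: (nilpotent_not_unit cf (or_introl nil_f) (g := g * e * a)).
by rewrite -[RHS]gaf -!mulrA fe.
Qed.

Lemma corner_unit f : corner f -> ~ annihilates f ->
  exists g, [/\ corner g, g * f = e & f * g = e].
Proof.
move=> cf fZ; have [nil_f|//] := corner_nilpotent_or_unit cf.
by case: fZ; apply: corner_annihilates.
Qed.

Lemma corner_nilpotent f : corner f -> annihilates f -> nilpotent f.
Proof.
move=> cf fZ; have [//|[g [_ gf _]]] := corner_nilpotent_or_unit cf.
by case: not_annihilates_e; rewrite -gf; apply: annihilatesMl.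
Qed.

(** Simplicity allows travel from [e Z] to [(1 - e) Z] and back: for suitable [u] and [v], the
    element [e u (1 - e) v e] fixes [e z], so it is a unit of the corner, and inverting it factors
    [e] through [1 - e]. *)
Lemma corner_summand : ~ annihilates (1 - e) ->
  exists a b : E, (a * (1 - e)) * ((1 - e) * b) = e.
Proof.
move=> eZ'; have [z [Zz ez0]] := eZ.
have [y [Zy ey0]] : exists y, Z y /\ (1 - e) *: y <> 0.
  apply: contrapT => N; apply: eZ' => y Zy; apply: contrapT => ey0.
  by apply: N; exists y.
have [u uE] := Z_simple (submoduleZ (1 - e) Zy) ey0 (submoduleZ e Zz).
have [v vE] := Z_simple (submoduleZ e Zz) ez0 Zy.
have e1 : (1 - e) * (1 - e) = 1 - e.
  by rewrite mulrBr mulr1 mulrBl mul1r ee subrr subr0.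
have [] := @corner_unit (e * (u * (1 - e) * v) * e).
- exact: corner_mul.
- move=> /(_ z Zz); apply/eqP; rewrite -!scalerA -vE -uE scalerA ee.
  exact/eqP.
move=> g [_ gf _]; exists (g * e * u), (v * e).
by rewrite -[RHS]gf -!mulrA [(1 - e) * (_ * _)]mulrA e1.
Qed.

Hypothesis e1Z : annihilates (1 - e).

Lemma annihilates_corner f : annihilates (e * f * e) -> annihilates f.
Proof.
move=> efe z Zz; rewrite -[f]mul1r -{1}(subrK e 1) mulrDl scalerDl.
rewrite (annihilatesMr _ e1Z)// add0r -[e * f]mulr1 -(subrK e 1) mulrDr
  scalerDl.
by rewrite (annihilatesMl _ e1Z)// efe// addr0.
Qed.

(** Modulo the annihilator of [Z], [f] agrees with [e f e], and the inverse of the latter in the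
    corner inverts [f]. This is the division ring property of [E / m]. *)
Lemma unit_mod_annihilates f : ~ annihilates f ->
  exists g, annihilates (g * f - 1).
Proof.
move=> fZ; have [] := @corner_unit (e * f * e); first exact: corner_mul.
  by move=> /annihilates_corner.
move=> g [[eg ge] gf _]; exists g; apply: annihilates_corner.
have -> : e * (g * f - 1) * e = 0; last by move=> z _; rewrite scale0r.
rewrite mulrBr mulr1 mulrBl ee [e * _]mulrA eg -[X in X * f]ge -!mulrA.
by rewrite -!mulrA in gf; rewrite gf subrr.
Qed.

End Corner.

(** * Modules over endomorphism algebras *)

Section EndModules.
Variables (k : fieldType) (A : algebra k).
Implicit Types M T X Y : lmodType A.

(** A separate name for [M], to carry its structure of left [End(M)]-module apart from that of
    [A]-module. *)
Definition evaluation M : Type := M.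

Section Evaluation.
Variable M : lmodType A.
HB.instance Definition _ := GRing.Zmodule.on (evaluation M).

Definition evaluation_scale (f : End_alg M) (x : evaluation M) : evaluation M :=
  (f : {linear M -> M}) x.

Fact evaluation_scaleA (f g : End_alg M) (x : evaluation M) :
  evaluation_scale f (evaluation_scale g x) = evaluation_scale (f * g) x.
Proof. by []. Qed.
Fact evaluation_scale1 : left_id 1 evaluation_scale.
Proof. by []. Qed.
Fact evaluation_scaleDr : right_distributive evaluation_scale +%R.
Proof. by move=> f x y; apply: (linearD (f : {linear M -> M})). Qed.
Fact evaluation_scaleDl (x : evaluation M) :
  {morph evaluation_scale^~ x : f g / f + g}.
Proof. by []. Qed.
HB.instance Definition _ := GRing.Zmodule_isLmodule.Build (End_alg M)
  (evaluation M) evaluation_scaleA evaluation_scale1 evaluation_scaleDr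
  evaluation_scaleDl.
End Evaluation.

(** [Hom(X, T)] with [End(T)] acting by composition on the left. *)
Definition hom_left X T : Type := hom X T.

Section HomLeft.
Variables X T : lmodType A.
HB.instance Definition _ := GRing.Zmodule.on (hom_left X T).

Definition hom_left_scale (f : End_alg T) (p : hom_left X T) : hom_left X T :=
  ((f : {linear T -> T}) \o (p : {linear X -> T}) : {linear X -> T}).

Fact hom_left_scaleA (f g : End_alg T) (p : hom_left X T) :
  hom_left_scale f (hom_left_scale g p) = hom_left_scale (f * g) p.
Proof. exact: hom_ext. Qed.
Fact hom_left_scale1 : left_id 1 hom_left_scale.
Proof. by move=> p; apply: hom_ext. Qed.
Fact hom_left_scaleDr : right_distributive hom_left_scale +%R.
Proof. by move=> f p q; apply: hom_ext => x;
  apply: (linearD (f : {linear T -> T})). Qed.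
Fact hom_left_scaleDl (p : hom_left X T) :
  {morph hom_left_scale^~ p : f g / f + g}.
Proof. by move=> f g; apply: hom_ext. Qed.
HB.instance Definition _ := GRing.Zmodule_isLmodule.Build (End_alg T)
  (hom_left X T) hom_left_scaleA hom_left_scale1 hom_left_scaleDr
  hom_left_scaleDl.

Lemma finite_dim_hom_left : finite_dim X -> finite_dim T ->
  finite_dim (hom_left X T).
Proof.
move=> [m dimX] [n dimT]; have [c [u [cu _]]] := has_dim_basis dimX.
have [p dimTm] := has_dim_ffun 'I_m dimT.
pose F (q : restrict (hom_left X T)) : {ffun 'I_m -> restrict T} :=
  [ffun i => (q : {linear X -> T}) (u i)].
have F_lin : linear F by move=> a q r; apply/ffunP => i; rewrite !ffunE.
have F_inj : injective (lin_of F_lin).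
  move=> q r /ffunP qr; apply: hom_ext => x; rewrite [x]cu.
  rewrite !(linear_sum (_ : {linear X -> T})); apply: eq_bigr => i _.
  have := qr i; rewrite !ffunE => qri.
  rewrite -[LHS]/((q : {linear X -> T}) (alg_map A (c i x) *: _)).
  rewrite -[RHS]/((r : {linear X -> T}) (alg_map A (c i x) *: _)).
  by rewrite !linearZ qri.
by have [q [? _ _]] := has_dim_inj F_inj dimTm; exists q.
Qed.
End HomLeft.

Lemma finite_dim_evaluation M : finite_dim M -> finite_dim (evaluation M).
Proof.
move=> [n dimM]; have f_lin : linear (id : restrict (evaluation M) ->
  restrict M) by [].
by have [q [? _ _]] := has_dim_inj (f := lin_of f_lin) (fun _ _ => id) dimM;
  exists q.
Qed.

Lemma finite_dim_End M : finite_dim M -> finite_dim (End_alg M)^o.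
Proof.
move=> Mfd; have f_lin : linear (id : (End_alg M)^o -> hom_left M M) by [].
exact: (finite_dim_inj (f := lin_of f_lin) (fun _ _ => id))
  (finite_dim_hom_left Mfd Mfd).
Qed.

(** Membership of [X] in [add(T)], as a factorization of the identity of [X] through a finite power
    of [T]. In this form, without a complement, it composes easily. *)
Definition sum_retract T X : Prop :=
  exists (I : finType) (a : I -> {linear X -> T}) (b : I -> {linear T -> X}),
    forall x, x = \sum_i b i (a i x).

Definition cogenerates M Y : Prop :=
  forall y : Y, y <> 0 -> exists f : {linear Y -> M}, f y <> 0.

End EndModules.

(** * The tower of quotients *)

Section Tower.
Variables (k : fieldType) (A : algebra k).
Implicit Types M T X Y : lmodType A.

(** The alternative is whether [1 - e] annihilates the simple submodule [Z]. If not, [S] is the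
    kernel of [e]; if so, [U] is the part of [M] killed by the annihilator [m] of [Z]. *)
Lemma tower_step M (Mfd : finite_dim M) : (exists x : M, x <> 0) ->
  (exists S : submodule M, (exists x, ~ S x) /\ sum_retract (sub S) M) \/
  (exists U : submodule M,
    [/\ exists2 u, U u & u <> 0,
        forall (h : {linear M -> quot U}) u, U u -> h u = 0,
        cogenerates M (quot U)
      & forall f : {linear M -> M}, (exists2 u, U u & f u <> 0) ->
          exists g : {linear M -> M}, forall u, U u -> g (f u) = u]).
Proof.
move=> [x0 x00].
pose E := End_alg M; pose V : lmodType E := evaluation M.
have Efd : finite_dim E^o := finite_dim_End Mfd.
have [Z [[z0 [Zz0 z00]] Zmin]] : exists Z : submodule V,
    (exists z, Z z /\ z <> 0) /\ forall S :
      submodule V, (exists z, S z /\ z <> 0) ->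
    (forall x, S x -> Z x) -> forall x, Z x -> S x.
  apply: (@minimal_submodule _ E V (fun S => exists z, S z /\ z <> 0)).
    exact: finite_dim_evaluation.
  have T_lin : linear (id : V -> V) by [].
  by exists (lin_im (lin_of T_lin)), x0; split=> //; exists x0.
have Z_simple z z' : Z z -> z <> 0 -> Z z' -> exists a : E, z' = a *: z.
  move=> Zz zn0 Zz'; have S_lin : linear (fun a : E^o => a *: z : V).
    by move=> a b c; rewrite scalerDl scalerA.
  have [||a <-] := Zmin (lin_im (lin_of S_lin)) _ _ _ Zz'; last by exists a.
  - by exists z; split=> //; exists 1; rewrite /= scale1r.
  - by move=> _ [a <-]; apply: submoduleZ.
(* [S] ranges over the images of idempotents that do not annihilate [Z], described as sets of fixed
   points. A smallest image makes its idempotent [e] minimal. *)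
pose P (S : submodule M) := exists e : E, [/\ e * e = e,
  exists z, Z z /\ e *: z <> 0 & forall x : M, S x <-> (e *: (x : V)) = x].
have [S [[e [ee eZ Se]] Smin]] : exists S, P S /\ forall S', P S' ->
    (forall x, S' x -> S x) -> forall x, S x -> S' x.
  apply: (@minimal_submodule _ A M P) => //.
  have T_lin : linear (id : M -> M) by [].
  exists (lin_im (lin_of T_lin)), 1; split; first exact: mulr1.
    by exists z0; rewrite scale1r.
  by move=> x; rewrite scale1r; split=> // _; exists x.
have e_min (g : E) : g * g = g -> e * g = g -> g * e = g ->
    (exists z, Z z /\ g *: z <> 0) -> g = e.
  move=> gg eg ge gZ.
  have PS' : P (lin_im (g : {linear M -> M})).
    exists g; split=> // x; split=> [[y <-]|gx]; last by exists x.
    by rewrite -[_ y]/(g *: (y : V)) scalerA gg.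
  rewrite -[LHS]ge; apply: hom_ext => x.
  have [] := Smin _ PS' _ (e *: (x : V)).
  - by move=> _ [y <-]; apply/Se; rewrite -[_ y]/(g *: (y : V)) scalerA eg.
  - by apply/Se; rewrite scalerA ee.
  move=> y yE; rewrite -[LHS]/(g *: (e *: (x : V))) -[e *: _]yE.
  by rewrite -[_ y]/(g *: (y : V)) scalerA gg.
have [e1Z|e1Z] := pselect (annihilates Z (1 - e)); last first.
  left; have [a [b abE]] := corner_summand Efd Z_simple ee eZ e_min e1Z.
  (* The kernel [R] of [e] is the image of [1 - e]. Both terms of [1 = (1 - e) + a (1 - e) b] factor
     through it. *)
  pose R := lin_ker (e : {linear M -> M}); exists R; split.
    apply: contrapT => N; have [z [_ ez]] := eZ; apply: ez.
    by apply: contrapT => ez; apply: N; exists z.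
  have e0 : e * (1 - e) = 0 by rewrite mulrBr mulr1 ee subrr.
  have R1 (f : E) x : R (((1 - e) * f : E) *: (x : V)).
    by rewrite /= -[LHS]/(e *: (((1 - e) * f : E) *: (x : V))) scalerA mulrA e0
      mul0r scale0r.
  pose p (f : E) : {linear M -> sub R} :=
    corestrict (f := ((1 - e) * f : E) : {linear M -> M}) (R1 f).
  pose q (f : E) : {linear sub R -> M} :=
    (f : {linear M -> M}) \o @subval _ _ R.
  exists 'I_2, (fun i => if i == 0 then p 1 else p b),
    (fun i => if i == 0 then q 1 else q a).
  have qpE f g x : q f (p g x) = f *: (((1 - e) * g : E) *: (x : V)).
    by rewrite -[LHS]/(f *: (subval _ (p g x) : V)) corestrictE.
  move=> x; rewrite big_ord_recl big_ord1 -[RHS]/(q 1 (p 1 x) + q a (p b x))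
    !qpE.
  rewrite mulr1 scale1r scalerA.
  have -> : a * ((1 - e) * b) = e.
    rewrite -[in RHS]abE -!mulrA; congr (a * _); rewrite [RHS]mulrA;
      congr (_ * _).
    by rewrite mulrBr mulr1 mulrBl mul1r ee subrr subr0.
  by rewrite -[RHS]/(((1 - e) *: (x : V) + e *: (x : V)) : V) -scalerDl subrK
    scale1r.
right.
pose m (f : E) : Prop := annihilates Z f.
have U_closed (a : A) (x y : M) : (forall f, m f -> f *: (x : V) = 0) ->
    (forall f, m f -> f *: (y : V) = 0) -> forall f, m f ->
      f *: ((a *: x + y : M) : V) = 0.
  move=> x0' y0' f mf; rewrite -[LHS]/((f : {linear M -> M}) (a *: x + y))
    linearP.
  by rewrite -[f x]/(f *: (x : V)) -[f y]/(f *: (y : V)) x0'// y0'// addr0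
    scaler0.
pose U := Submodule (submodule_set := fun x : M => forall f, m f ->
  f *: (x : V) = 0)
  (fun f _ => scaler0 _ _) U_closed.
pose fac (f : E) (mf : m f) : {linear quot U -> M} :=
  quot_lift (f := f : {linear M -> M}) (fun x (Ux : U x) => Ux f mf).
have facE f mf x : @fac f mf (quot_proj U x) = f *: (x : V)
  by apply: quot_liftE.
have e1M f : m f -> m (e * f * e) by move=> mf;
  apply/annihilatesMr/annihilatesMl.
exists U; split.
- by exists z0 => // f /(_ z0 Zz0).
- move=> h u Uu; have [x hx] := quot_proj_surj (h u).
  rewrite -hx; apply/quot_proj_eq0 => f mf; rewrite -(facE f mf) hx.
  (* Let [fh] be [h] followed by the map [M / U -> M] induced by [f]. If it did
     not annihilate [Z], [e fh e] would be a unit of the corner. Up to a map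
     annihilating [Z] it factors through the map induced by [e f e], so
     [e f e] would be onto [e M]; but it is nilpotent. *)
  pose fh : E := fac f mf \o h; rewrite -[LHS]/(fh *: (u : V)).
  apply: Uu.
  apply: (annihilates_corner e1Z).
  apply: contrapT => N.
  have [g [cg gE Eg]] := corner_unit Efd Z_simple ee eZ e_min (corner_mul ee _)
    N.
  pose a : E := fac _ (e1M f mf) \o h.
  pose s : {linear quot U -> M} :=
    quot_lift (f := (1 - e : E) : {linear M -> M})
      (fun x (Ux : U x) => Ux _ e1Z).
  pose sh : E := s \o h.
  have fhE : e * fh = a + e * f * sh.
    apply: hom_ext => y; have [z zE] := quot_proj_surj (h y).
    rewrite -[LHS]/(e *: (fac f mf (h y) : V))
      -[RHS]/(fac _ (e1M f mf) (h y) + (e * f) *: (s (h y) : V)).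
    by rewrite -zE !facE !scalerA -[RHS]scalerDl mulrBr mulr1 addrC subrK.
  have ma : ~ m (a * e).
    move=> ma; apply: N; rewrite -/fh fhE mulrDl; apply: annihilatesD => //.
    exact/annihilatesMr/annihilatesMr/annihilatesMl.
  have ea : e * a = a.
    apply: hom_ext => y; have [z zE] := quot_proj_surj (h y).
    rewrite -[LHS]/(e *: (fac _ (e1M f mf) (h y) : V))
      -[RHS]/(fac _ (e1M f mf) (h y)).
    by rewrite -zE facE scalerA !mulrA ee.
  have [|g' [_ _ ag']] := corner_unit Efd Z_simple ee eZ e_min
    (corner_mul ee a).
    by rewrite ea.
  have [ew we] := corner_mul ee f.
  have [n wn0] := corner_nilpotent Efd ee eZ e_min (conj ew we) (e1M f mf).
  have w_surj (y : V) : exists z : V, e *: y = (e * f * e) *: z.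
    have [z zE] := quot_proj_surj (h ((e * g') *: y)).
    exists z; rewrite -(facE _ (e1M f mf)) zE -{1}ag' ea -mulrA -scalerA.
    by [].
  have wn_surj j : forall y : V, exists z : V, e *: y = (e * f * e) ^+ j *: z.
    elim: j => [|j IHj] y; first by exists (e *: y); rewrite scale1r.
    have [z ->] := w_surj y; have [t tE] := IHj z.
    by exists t; rewrite exprS -[in RHS]scalerA -tE scalerA we.
  have [z [_ ez0]] := eZ; apply: ez0; have [y ->] := wn_surj n z.
  by rewrite wn0 scale0r.
- move=> y yn0; have [x xE] := quot_proj_surj y.
  have : ~ U x by move=> /quot_proj_eq0; rewrite xE.
  rewrite /= => /existsNP[f /not_implyP[mf fx]].
  by exists (fac f mf); rewrite -xE facE.
(* As [m] kills [U], a map [f] that is nonzero on [U] lies outside [m]; its inverse modulo [m]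
   inverts it on [U]. *)
move=> f [u Uu fu].
have [g mg] := unit_mod_annihilates Efd Z_simple ee eZ e_min e1Z (f := f : E)
  (fun mf => fu (Uu _ mf)).
exists (g : {linear M -> M}) => v /(_ _ mg); rewrite scalerBl scale1r => /eqP.
by rewrite subr_eq0 => /eqP.
Qed.
End Tower.

Section TowerExistence.
Variables (k : fieldType) (A : algebra k).
Implicit Types M T X Y : lmodType A.

Lemma sum_retract_trans T Y X : sum_retract T Y -> sum_retract Y X ->
  sum_retract T X.
Proof.
move=> [I [a [b ab]]] [J [c [d cd]]]; exists (J * I)%type.
exists (fun p => a p.2 \o c p.1), (fun p => d p.1 \o b p.2) => x.
rewrite {1}[x]cd -(pair_bigA _ (fun j i => d j (b i (a i (c j x))))).
by apply: eq_bigr => j _; rewrite {1}[c j x]ab linear_sum.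
Qed.

Lemma sum_retract_of_retract T X (i : {linear X -> T}) (r : {linear T -> X}) :
  cancel i r -> sum_retract T X.
Proof.
by move=> irK; exists unit, (fun=> i), (fun=> r) => x;
  rewrite big_const card_unit /= irK addr0.
Qed.

Lemma sum_retract_refl T : sum_retract T T.
Proof. exact: (@sum_retract_of_retract T T idfun idfun). Qed.

Fact pairl_linear X Y : linear (fun x : X => (x, 0) : X * Y).
Proof. by move=> a x y; congr pair; rewrite /= scaler0 addr0. Qed.
Definition pairl X Y : {linear X -> (X * Y)%type} := lin_of (@pairl_linear X Y).

Fact pairr_linear X Y : linear (fun y : Y => (0, y) : X * Y).
Proof. by move=> a x y; congr pair; rewrite /= scaler0 addr0. Qed.
Definition pairr X Y : {linear Y -> (X * Y)%type} := lin_of (@pairr_linear X Y).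

Fact fst_linear X Y : linear (fun p : X * Y => p.1).
Proof. by []. Qed.
Definition fstl X Y : {linear (X * Y)%type -> X} := lin_of (@fst_linear X Y).

Fact snd_linear X Y : linear (fun p : X * Y => p.2).
Proof. by []. Qed.
Definition sndl X Y : {linear (X * Y)%type -> Y} := lin_of (@snd_linear X Y).

Lemma sum_retract_prodl X Y : sum_retract (X * Y)%type X.
Proof. exact: (@sum_retract_of_retract _ _ (pairl X Y) (fstl X Y)). Qed.

Lemma sum_retract_prodr X Y : sum_retract (X * Y)%type Y.
Proof. exact: (@sum_retract_of_retract _ _ (pairr X Y) (sndl X Y)). Qed.

Lemma cogenerates_trans M Y X : cogenerates M Y -> cogenerates Y X ->
  cogenerates M X.
Proof. by move=> MY YX x /YX[f /MY[g gf]]; exists (g \o f). Qed.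

Lemma cogenerates_sub M (S : submodule M) : cogenerates M (sub S).
Proof.
move=> x x0; exists (subval S) => Sx; apply: x0; apply: (@subval_inj _ _ S).
by rewrite Sx linear0.
Qed.

(** The tail [T] is built from [M / U] or from a smaller module having [M / U] in its [add]; hence
    [M / U] only has to be a retract of a power of [T]. *)
Inductive tower : lmodType A -> Prop :=
| tower_zero T : (forall x : T, x = 0) -> tower T
| tower_cons M (U : submodule M) T :
    tower T -> sum_retract T (quot U) ->
    (forall (h : {linear M -> T}) u, U u -> h u = 0) ->
    (forall f : {linear M -> M}, (exists2 u, U u & f u <> 0) ->
       exists g : {linear M -> M}, forall u, U u -> g (f u) = u) ->
    tower (M * T)%type.

(** Induction on the dimension of [M]. Cogeneration is carried along to show that maps [M -> T] kill
    [U]: a nonzero value in [T] would be detected by a map [T -> M / U], giving a map [M -> M / U]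
    that is nonzero on [U]. *)
Lemma tower_exists M : finite_dim M ->
  exists T, [/\ tower T, sum_retract T M, cogenerates M T & finite_dim T].
Proof.
move=> [n]; have [m] := ubnP n; elim: m n M => // m IHm n M /ltnSE lenm dimM.
have Mfd : finite_dim M by exists n.
have [Mn0|M0] := pselect (exists x : M, x <> 0); last first.
  have {}M0 (x : M) : x = 0 by apply: contrapT => xn0; apply: M0; exists x.
  by exists M; split=> //; [apply: tower_zero|apply: sum_retract_refl].
have [[S [[x Sx] addrM]]|[U [[u Uu u0] hU cogU divU]]] := tower_step Mfd Mn0.
  have [p [dimS lepn pn]] := dim_sub S dimM.
  have ltpn : (p < n)%N by rewrite ltn_neqAle lepn andbT;
    apply/eqP => /pn/(_ x).
  have [T [towT addrT cogT Tfd]] := IHm _ _ (leq_trans ltpn lenm) dimS.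
  by exists T; split=> //; [apply: sum_retract_trans addrM|apply:
    cogenerates_trans cogT; apply: cogenerates_sub].
have [p [dimU lepn pn]] := dim_quot U dimM.
have ltpn : (p < n)%N by rewrite ltn_neqAle lepn andbT;
  apply/eqP => /pn/(_ u Uu).
have [T [towT addrT cogT Tfd]] := IHm _ _ (leq_trans ltpn lenm) dimU.
exists (M * T)%type; split.
- apply: (tower_cons (U := U)) => // h v Uv; apply: contrapT => /cogT[f].
  by rewrite -[f _]/((f \o h) v) hU.
- exact: sum_retract_prodl.
- move=> [v t] vt0; have [v0|vn0] := pselect (v = 0); last by exists (fstl M T).
  have [|f ft] := cogenerates_trans cogU cogT (y := t);
    last by exists (f \o sndl M T).
  by move=> t0; apply: vt0; rewrite v0 t0.
- exact: finite_dim_prod.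
Qed.

End TowerExistence.

(** * Projective and global dimension *)

Section ProjectiveDimension.
Variables (k : fieldType) (A : algebra k).
Implicit Types P K M X Y Z : lmodType A.

Lemma range_setT X Y (f : {linear X -> Y}) :
  range f = setT <-> forall y, exists x, f x = y.
Proof.
split=> [fT y|f_surj].
  by have [x _ fx] : range f y by [rewrite fT]; exists x.
by apply/seteqP; split=> // y _; have [x <-] := f_surj y; exists x.
Qed.

Lemma linear_lift X Y Z (i : {linear Y -> Z}) (f : {linear X -> Z}) :
  injective i -> (forall x, exists y, i y = f x) ->
  exists h : {linear X -> Y}, forall x, i (h x) = f x.
Proof.
move=> i_inj /choice[h hE].
have h_lin : linear h by move=> a x y; apply: i_inj;
  rewrite linearP !hE linearP.
by exists (lin_of h_lin).
Qed.

Definition short_exact X Y Z (i : {linear X -> Y}) (p : {linear Y -> Z}) :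
  Prop :=
  [/\ injective i, forall y, p y = 0 <-> exists x, i x = y
    & forall z, exists y, p y = z].

Lemma projective_moduleP P : projective_module P <->
  forall X Y (g : {linear X -> Y}) (f : {linear P -> Y}),
  finite_dim X -> finite_dim Y -> (forall y, exists x, g x = y) ->
  exists h : {linear P -> X}, forall x, g (h x) = f x.
Proof.
split=> projP X Y => [g f Xfd Yfd /range_setT gT|Xfd Yfd g f /range_setT
  g_surj].
  by have [h gh] := projP X Y Xfd Yfd g f gT; exists h.
by have [h gh] := projP X Y g f Xfd Yfd g_surj; exists h.
Qed.

Lemma projective_of_retract P (I : finType) (Q : I -> lmodType A)
    (a : forall i, {linear P -> Q i}) (b : forall i, {linear Q i -> P}) :
  (forall i, projective_module (Q i)) ->
  (forall x, x = \sum_i b i (a i x)) -> projective_module P.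
Proof.
move=> projQ ab; apply/projective_moduleP => X Y g f Xfd Yfd g_surj.
have hP i : exists h : {linear Q i -> X}, forall x, g (h x) = f (b i x).
  have [//|h hE] := (projective_moduleP (Q i)).1 (projQ i) _ _ g (f \o b i) Xfd
    Yfd.
  by exists h.
pose h i := sval (cid (hP i)).
have h_lin : linear (fun x => \sum_i h i (a i x)).
  move=> c x y; rewrite scaler_sumr -big_split; apply: eq_bigr => i _.
  by rewrite !linearP.
exists (lin_of h_lin) => x /=; rewrite linear_sum [in RHS](ab x) linear_sum.
by apply: eq_bigr => i _; rewrite /h; case: cid => /= ? ->.
Qed.

Lemma projective_prod P M :
  projective_module P -> projective_module M -> projective_module (P * M)%type.
Proof.
move=> projP projM; pose Q (i : bool) := if i then P else M.
pose a (i : bool) : {linear (P * M)%type -> Q i} :=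
  match i with true => fstl P M | false => sndl P M end.
pose b (i : bool) : {linear Q i -> (P * M)%type} :=
  match i with true => pairl P M | false => pairr P M end.
apply: (@projective_of_retract _ bool Q a b) => [[]//|[x y]].
by rewrite big_bool /=; congr pair; rewrite /= ?addr0 ?add0r.
Qed.

(** Bounded projective dimension by successive syzygies, suited to induction; [pdim_le_resolution]
    splices these into a resolution. *)
Fixpoint pdim_le n X : Prop :=
  match n with
  | 0 => finite_dim X /\ projective_module X
  | n.+1 => exists P K (i : {linear K -> P}) (p : {linear P -> X}),
      [/\ finite_dim P, projective_module P, short_exact i p & pdim_le n K]
  end.

Lemma pdim_leS n X : pdim_le n X -> pdim_le n.+1 X.
Proof.
elim: n X => [X [Xfd projX]|n IHn X [P [K [i [p [? ? ? ?]]]]]]; last first.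
  by exists P, K, i, p; split=> //; apply: IHn.
exists X, (sub (lin_ker (idfun : {linear X -> X}))), (subval _), idfun.
split=> //.
  split=> [|x|x]; [exact: subval_inj| |by exists x].
  split=> [x0|[y <-]]; last exact: (subvalP y).
  by exists 0; rewrite linear0.
split; first exact: finite_dim_sub.
apply/projective_moduleP => Y Z g f _ _ _; exists \0 => x.
have -> : x = 0 by apply: subval_inj; rewrite linear0; apply: (subvalP x).
by rewrite !linear0.
Qed.

Lemma pdim_le_leq m n X : (m <= n)%N -> pdim_le m X -> pdim_le n X.
Proof.
by move=> /subnKC <-; elim: (n - m)%N => [|d IHd];
  rewrite ?addn0// addnS => /IHd/pdim_leS.
Qed.

(** Horseshoe lemma: lifting [pQ] through [p] gives a surjection [f] from [P * Q] onto [Y], whose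
    kernel is an extension of [L] by [K]. *)
Lemma pdim_le_extension n X Y Z (i : {linear X -> Y}) (p : {linear Y -> Z}) :
  finite_dim Y -> short_exact i p -> pdim_le n X -> pdim_le n Z -> pdim_le n Y.
Proof.
elim: n X Y Z i p => [|n IHn] X Y Z i p Yfd [i_inj ip p_surj].
  move=> [Xfd projX] [Zfd projZ]; split=> //.
  have [s ps] := (projective_moduleP Z).1 projZ _ _ p idfun Yfd Zfd p_surj.
  have [|r ri] := @linear_lift _ _ _ i (idfun \- (s \o p)) i_inj.
    by move=> y; apply/ip; rewrite /= linearB ps subrr.
  pose Q (b : bool) := if b then X else Z.
  pose a (b : bool) : {linear Y -> Q b} := match b with true => r | false =>
    p end.
  pose c (b : bool) : {linear Q b -> Y} := match b with true => i | false =>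
    s end.
  apply: (@projective_of_retract _ bool Q a c) => [[]//|y].
  by rewrite big_bool /= ri subrK.
move=> [P [K [iP [pP [Pfd projP [iP_inj iPp pP_surj] pdK]]]]].
move=> [Q [L [iQ [pQ [Qfd projQ [iQ_inj iQp pQ_surj] pdL]]]]].
have Zfd := finite_dim_surj p_surj Yfd.
have [s ps] := (projective_moduleP Q).1 projQ _ _ p pQ Yfd Zfd p_surj.
pose f : {linear (P * Q)%type -> Y} := (i \o pP \o fstl P Q) \+ (s \o sndl P Q).
have PQfd := finite_dim_prod Pfd Qfd.
exists (P * Q)%type, (sub (lin_ker f)), (subval _), f; split=> //.
- exact: projective_prod.
- split=> [|x|y]; first exact: subval_inj.
  + by split=> [fx|[y <-]]; [exists (insub_mod (S := lin_ker f) fx);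
    rewrite insub_modK|apply: (subvalP y)].
  have [q qE] := pQ_surj (p y).
  have /ip[x xE] : p (y - s q) = 0 by rewrite linearB ps qE subrr.
  have [u uE] := pP_surj x.
  by exists (u, q); rewrite /= uE xE subrK.
have [|j jE] := @linear_lift _ _ _ (subval (lin_ker f)) (pairl P Q \o iP)
  (@subval_inj _ _ _).
  move=> x; suff fx : lin_ker f (pairl P Q (iP x)) by exists (insub_mod fx);
    apply: insub_modK.
  rewrite /= linear0 addr0; have -> : pP (iP x) = 0 by apply/iPp; exists x.
  exact: linear0.
have [|t tE] := @linear_lift _ _ _ iQ (sndl P Q \o subval (lin_ker f)) iQ_inj.
  move=> x; apply/iQp; have /(congr1 p) := subvalP x.
  rewrite /= linear0 linearD ps; have -> :
    p (i (pP (subval (lin_ker f) x).1)) = 0 by apply/ip; eexists.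
  by rewrite add0r.
apply: (IHn _ _ _ j t) => //; first exact: finite_dim_sub.
split=> [x y /(congr1 (subval _))|x|y].
- by rewrite !jE => -[/iP_inj].
- split=> [tx|[y <-]]; last first.
    by apply: iQ_inj; rewrite tE linear0 -[LHS]/((subval _ (j y)).2) jE.
  have x2 : (subval _ x).2 = 0 by rewrite -[LHS]tE tx linear0.
  have /= := subvalP x; rewrite x2 linear0 addr0 -(linear0 i) =>
    /i_inj/iPp[y yE].
  exists y; apply: (@subval_inj _ _ (lin_ker f)); rewrite jE.
  by rewrite [RHS]surjective_pairing x2 -yE.
have [x xE] : exists x, i x = - s (iQ y).
  by apply/ip; rewrite linearN ps; have -> : pQ (iQ y) = 0;
    [apply/iQp; exists y|rewrite oppr0].
have [u uE] := pP_surj x.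
have fuy : lin_ker f (u, iQ y) by rewrite /= uE xE addNr.
by exists (insub_mod fuy); apply: iQ_inj;
  rewrite tE -[LHS]/((subval _ (insub_mod fuy)).2) insub_modK.
Qed.

End ProjectiveDimension.

(** * Finite global dimension of [End(T)] for a tower [T] *)

Section GlobalDimension.
Variables (k : fieldType) (A : algebra k) (T : lmodType A).
Hypothesis Tfd : finite_dim T.
Local Notation E := (End_alg T).
Implicit Types M X Y : lmodType A.

Lemma hom_sumE X Y (I : finType) (f : I -> hom X Y) x :
  ((\sum_i f i : hom X Y) : {linear X -> Y}) x = \sum_i (f i : {linear X -> Y})
    x.
Proof. exact: (big_morph (fun f : hom X Y => (f : {linear X -> Y}) x)). Qed.

(** The maps [a i] generate [Hom(X, T)], as [p] is the sum of the [(p \o b i) \o a i]; lifting the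
    images of these generators with the same coefficients lifts [f]. *)
Lemma projective_hom_left X : sum_retract T X ->
  projective_module (hom_left X T).
Proof.
move=> [I [a [b ab]]]; apply/projective_moduleP => Y Z g f _ _ g_surj.
have /choice[y yE] i : exists y, g y = f (a i : hom_left X T) by apply: g_surj.
pose pb (p : hom_left X T) i : E := (p : {linear X -> T}) \o b i.
have h_lin : linear (fun p => \sum_i pb p i *: y i).
  move=> c p q; rewrite scaler_sumr -big_split; apply: eq_bigr => i _ /=.
  by rewrite scalerA -scalerDl; congr (_ *: _); apply: hom_ext.
exists (lin_of h_lin) => p; rewrite /= linear_sum.
transitivity (f (\sum_i pb p i *: (a i : hom_left X T))).
  by rewrite linear_sum; apply: eq_bigr => i _; rewrite !linearZ yE.
congr (f _); apply: hom_ext => x; rewrite hom_sumE.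
by rewrite [in RHS](ab x) linear_sum.
Qed.

(** [F] is a module over the quotient of [E] by the ideal of maps factoring through powers of
    [X]. *)
Definition vanishes (F : lmodType E) X : Prop :=
  forall (a : {linear T -> X}) (b : {linear X -> T}) (x : F),
    (b \o a : E) *: x = 0.

Lemma vanishes_prod F X Y : vanishes F X -> vanishes F Y ->
  vanishes F (X * Y)%type.
Proof.
move=> FX FY a b x.
have -> : (b \o a : E) =
    ((b \o pairl X Y) \o (fstl X Y \o a) : E) +
      ((b \o pairr X Y) \o (sndl X Y \o a) : E).
  apply: hom_ext => t; rewrite -[RHS]/(b (pairl X Y (a t).1) + b
    (pairr X Y (a t).2)).
  rewrite -linearD; congr (b _); rewrite [LHS]surjective_pairing.
  by congr pair; rewrite ?addr0 ?add0r.
by rewrite scalerDl FX FY addr0.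
Qed.

Lemma vanishes_sum_retract F X Y : sum_retract Y X -> vanishes F Y ->
  vanishes F X.
Proof.
move=> [I [c [d cd]]] FY a b x.
have -> : (b \o a : E) = \sum_i ((b \o d i) \o (c i \o a) : E).
  by apply: hom_ext => t; rewrite hom_sumE /= [in LHS](cd (a t)) linear_sum.
by rewrite scaler_suml big1// => i _; apply: FY.
Qed.

Lemma finite_dim_sum_retract X : sum_retract T X -> finite_dim X.
Proof.
move=> [I [a [b ab]]].
have f_lin : linear (fun x => [ffun i => a i x]).
  by move=> c x y; apply/ffunP => i; rewrite !ffunE linearP.
apply: (finite_dim_inj (f := lin_of f_lin)) (finite_dim_ffun I Tfd).
move=> x y /ffunP xy; rewrite [x]ab [y]ab; apply: eq_bigr => i _.
by have := xy i; rewrite !ffunE => ->.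
Qed.

Section Step.
Variables (M T' : lmodType A) (U : submodule M) (n : nat).
Hypothesis TM : sum_retract T M.
Hypothesis TT' : sum_retract T T'.
Hypothesis T'U : sum_retract T' (quot U).
Hypothesis hom_U : forall (h : {linear M -> T'}) u, U u -> h u = 0.
Hypothesis end_U : forall f : {linear M -> M}, (exists2 u, U u & f u <> 0) ->
  exists g : {linear M -> M}, forall u, U u -> g (f u) = u.
Hypothesis pdim_vanishes : forall F : lmodType E,
  finite_dim F -> vanishes F (M * T')%type -> pdim_le n F.

(* An element [x] not killed by [b \o a : T -> M -> T] defines
   [phi : Hom(M, T) -> F], [p |-> (p \o a) x]. Its kernel contains
   [Hom(M / U, T)], which is projective, and the quotient of [ker phi] by it is
   killed by the maps through [M * T']: if [d \o c : T -> M -> T] did not kill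
   the class of [p], [end_U] would give [g] with [g c p = 1] on [U], whence
   [b = b g c p + r] with [r] in [Hom(M / U, T)] and [phi b = 0]. The quotient
   of [F] by the image of [phi] has smaller dimension. *)
Lemma pdim_le_step (F : lmodType E) :
  finite_dim F -> vanishes F T' -> pdim_le n.+1 F.
Proof.
move=> [d]; have [m] := ubnP d; elim: m d F =>
  // m IHm d F /ltnSE ledm dimF FT'.
have Ffd : finite_dim F by exists d.
have [FM|] := pselect (vanishes F M).
  by apply/pdim_leS/pdim_vanishes => //; apply: vanishes_prod.
move=> /existsNP[a /existsNP[b /existsNP[x bax]]].
have Mfd := finite_dim_sum_retract TM.
have phi_lin : linear (fun p : hom_left M T =>
  ((p : {linear M -> T}) \o a : E) *: x).
  by move=> c p q; rewrite scalerA -scalerDl; congr (_ *: _); apply: hom_ext.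
pose phi : {linear hom_left M T -> F} := lin_of phi_lin.
pose L := sub (lin_ker phi).
pose jp (q : hom_left (quot U) T) : hom_left M T :=
  (q : {linear quot U -> T}) \o quot_proj U.
have jp_lin : linear jp by move=> c p q; apply: hom_ext.
have phi_jp q : phi (jp q) = 0.
  rewrite -[RHS](vanishes_sum_retract T'U FT' (quot_proj U \o a) q x).
  by congr (_ *: _); apply: hom_ext.
pose j : {linear hom_left (quot U) T -> L} :=
  corestrict (f := lin_of jp_lin) (S := lin_ker phi) phi_jp.
have jE q : subval _ (j q) = jp q by apply: corestrictE.
have imj (l : L) : (forall u, U u -> (subval _ l : {linear M -> T}) u = 0) ->
  exists q, j q = l.
  move=> lU; exists (quot_lift lU : {linear quot U -> T}).
  apply: (@subval_inj _ _ (lin_ker phi)); rewrite jE; apply: hom_ext => y.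
  exact: quot_liftE.
have homMT_fd := finite_dim_hom_left Mfd Tfd.
have Lfd : finite_dim L by apply: finite_dim_sub.
have pdL : pdim_le n L.
  apply: (pdim_le_extension (i := j) (p := quot_proj (lin_im j))) => //.
  - split=> [q q'|y|y]; last exact: quot_proj_surj.
    + move=> /(congr1 (subval _)); rewrite !jE => qq'; apply: hom_ext => y.
      have [z <-] := quot_proj_surj y.
      by have /(congr1 (fun p : hom_left M T => (p : {linear M -> T}) z)) :=
        qq'.
    + exact: quot_proj_eq0.
  - apply: (pdim_le_leq (leq0n n)); split;
    first exact/finite_dim_hom_left/Tfd/finite_dim_quot.
    exact/projective_hom_left/(sum_retract_trans TT').
  apply: pdim_vanishes; first exact: finite_dim_quot.
  apply: vanishes_prod => c e y; have [l <-] := quot_proj_surj y;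
    rewrite -linearZ; apply/quot_proj_eq0/imj => u Uu; rewrite linearZ.
    apply: contrapT => ecu; have [|g gU] :=
      end_U (f := c \o (subval _ l : {linear M -> T})).
      exists u => // clu; apply: ecu.
      by rewrite -[LHS]/(e ((c \o (subval _ l : {linear M -> T})) u)) clu
        linear0.
    pose l' : hom_left M T := subval _ l.
    pose r : hom_left M T := (b : hom_left M T) - (b \o g \o c : E) *: l'.
    have rU v : U v -> (r : {linear M -> T}) v = 0.
      move=> Uv; rewrite -[LHS]/(b v - b (g (c ((l' : {linear M -> T}) v)))).
      by have /= -> := gU v Uv; rewrite subrr.
    apply: bax; rewrite -[LHS]/(phi b).
    have -> : (b : hom_left M T) = r + (b \o g \o c : E) *: l' by rewrite subrK.
    have -> : r = jp (quot_lift rU : {linear _ -> _}).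
      by apply: hom_ext => v; rewrite -[RHS]/(quot_lift rU (quot_proj U v))
        quot_liftE.
    have phi_l' : phi l' = 0 := subvalP l.
    by rewrite linearD phi_jp add0r linearZZ phi_l' scaler0.
  have := hom_U (c \o (subval _ l : {linear M -> T})) Uu.
  by move=> /= clu; rewrite -[LHS]/(e (c ((subval _ l : {linear M -> T}) u)))
    clu linear0.
have im_phi y : lin_im phi (phi y) by exists y.
have pdI : pdim_le n.+1 (sub (lin_im phi)).
  exists (hom_left M T), L, (subval _), (corestrict im_phi); split=> //.
    exact: projective_hom_left.
  split=> [|p|y]; first exact: subval_inj.
    split=> [phi_p|[l <-]].
      have {}phi_p : phi p = 0 by rewrite -(corestrictE im_phi) phi_p linear0.
      by exists (insub_mod (S := lin_ker phi) phi_p); rewrite insub_modK.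
    by apply: (@subval_inj _ _ (lin_im phi)); rewrite corestrictE linear0;
      apply: (subvalP l).
  have [p pE] := subvalP y.
  by exists p; apply: (@subval_inj _ _ (lin_im phi)); rewrite corestrictE.
have [d' [dimF' led' d'd]] := dim_quot (lin_im phi) dimF.
have ltd' : (d' < d)%N.
  rewrite ltn_neqAle led' andbT; apply/eqP => /d'd/(_ (phi b) (im_phi _)).
  exact: bax.
apply: (pdim_le_extension Ffd _ pdI (IHm _ _ (leq_trans ltd' ledm) dimF' _)).
- split=> [|y|y]; [exact: subval_inj| |exact: quot_proj_surj].
  split=> [/quot_proj_eq0 yI|[z <-]]; last exact/quot_proj_eq0/subvalP.
  by exists (insub_mod yI); apply: insub_modK.
- by move=> c e y; have [z <-] := quot_proj_surj y;
  rewrite -linearZ FT' linear0.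
Qed.
End Step.

(** Each level removed from the tower raises the bound by one and weakens the vanishing condition,
    which is empty once the tail is zero. *)
Lemma tower_pdim_le T' : tower T' -> sum_retract T T' -> forall n,
  (forall F : lmodType E, finite_dim F -> vanishes F T' -> pdim_le n F) ->
  exists n, forall F : lmodType E, finite_dim F -> pdim_le n F.
Proof.
elim=> [T0 T00|M U T1 _ IH T1U hU endU] addT n pdn.
  exists n => F Ffd; apply: pdn => // a b x.
  rewrite (_ : (b \o a : E) = 0) ?scale0r//; apply: hom_ext => t /=.
  by rewrite [a t]T00 linear0.
have addM := sum_retract_trans addT (sum_retract_prodl M T1).
have addT1 := sum_retract_trans addT (sum_retract_prodr M T1).
by apply: (IH addT1 n.+1) => F; apply: pdim_le_step T1U hU endU pdn F.
Qed.

(** The induction starts at bound [0]: if maps through [T] itself act as zero, so does the identity,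
    and [F = 0]. *)
Lemma tower_gldim_finite : tower T ->
  exists n, forall F : lmodType E, finite_dim F -> pdim_le n F.
Proof.
move=> towT; apply: (tower_pdim_le towT (sum_retract_refl T) (n := 0)) =>
  F Ffd FT.
have F0 (x : F) : x = 0.
  rewrite -[x]scale1r -(FT idfun idfun x); congr (_ *: _); exact: hom_ext.
split=> //; apply/projective_moduleP => X Y g f _ _ _; exists \0 => x.
by rewrite [x]F0 !linear0.
Qed.

End GlobalDimension.

(** * Injective modules and envelopes *)

Section Injective.
Variables (k : fieldType) (A : algebra k).
Implicit Types I M Q X Y Z : lmodType A.

Lemma injective_moduleP Q : injective_module Q <->
  forall X Y (g : {linear X -> Y}) (f : {linear X -> Q}),
  finite_dim X -> finite_dim Y -> injective g ->
  exists h : {linear Y -> Q}, forall x, h (g x) = f x.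
Proof.
split=> injQ X Y => [g f Xfd Yfd g_inj|Xfd Yfd g f g_inj].
  by have [h gh] := injQ X Y Xfd Yfd g f g_inj; exists h.
by have [h gh] := injQ X Y g f Xfd Yfd g_inj; exists h.
Qed.

Lemma injective_of_retract M (I : finType) (Q : I -> lmodType A)
    (a : forall i, {linear M -> Q i}) (b : forall i, {linear Q i -> M}) :
  (forall i, injective_module (Q i)) ->
  (forall x, x = \sum_i b i (a i x)) -> injective_module M.
Proof.
move=> injQ ab; apply/injective_moduleP => X Y g f Xfd Yfd g_inj.
have hP i : exists h : {linear Y -> Q i}, forall x, h (g x) = a i (f x).
  have [//|h hE] := (injective_moduleP (Q i)).1 (injQ i) _ _ g (a i \o f) Xfd
    Yfd.
  by exists h.
pose h i := sval (cid (hP i)).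
have h_lin : linear (fun y => \sum_i b i (h i y)).
  move=> c x y; rewrite scaler_sumr -big_split; apply: eq_bigr => i _.
  by rewrite !linearP.
exists (lin_of h_lin) => x /=; rewrite [in RHS](ab (f x)).
by apply: eq_bigr => i _; rewrite /h; case: cid => /= ? ->.
Qed.

Fact ffun_eval_linear (I : finType) M i : linear (fun x : {ffun I -> M} => x i).
Proof. by move=> a x y; rewrite !ffunE. Qed.

Fact ffun_single_linear (I : finType) M i :
  linear (fun x : M => [ffun j : I => if j == i then x else 0]).
Proof.
move=> a x y; apply/ffunP => j; rewrite !ffunE.
by case: eqP => // _; rewrite scaler0 addr0.
Qed.

Lemma ffun_sum_single (I : finType) M (x : {ffun I -> M}) :
  x = \sum_i lin_of (@ffun_single_linear I M i)
    (lin_of (@ffun_eval_linear I M i) x).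
Proof.
apply/ffunP => j; rewrite sum_ffunE (bigD1 j)//= ffunE eqxx big1 ?addr0// => i.
by rewrite ffunE eq_sym => /negPf ->.
Qed.

Lemma projective_ffun (I : finType) M :
  projective_module M -> projective_module {ffun I -> M}.
Proof.
move=> projM; apply: (@projective_of_retract _ _ {ffun I -> M} I (fun=> M) _ _ _
  (@ffun_sum_single I M)).
by [].
Qed.

Lemma injective_ffun (I : finType) M :
  injective_module M -> injective_module {ffun I -> M}.
Proof.
move=> injM; apply: (@injective_of_retract {ffun I -> M} I (fun=> M) _ _ _
  (@ffun_sum_single I M)).
by [].
Qed.

Lemma alg_scaleE c (x : restrict A^o) : c *: x = alg_map A c * x.
Proof. by []. Qed.

Definition dapp (f : dual_regular A) : {linear restrict A^o -> k^o} := f.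

Lemma dapp_sum (I : finType) (f : I -> dual_regular A) x :
  dapp (\sum_i f i) x = \sum_i dapp (f i) x.
Proof. exact: (big_morph (fun f => dapp f x)). Qed.

Lemma dappZ a f x : dapp (a *: f) x = dapp f (x * a).
Proof. by []. Qed.

Lemma dappZk c f x : dapp (alg_map A c *: f) x = c * dapp f x.
Proof. by rewrite dappZ -[x * _](alg_mapC c x) -alg_scaleE linearZ. Qed.

(** Evaluation at [1] identifies [Hom(Y, D(A))] with the [k]-dual of [Y]. The functional [l] of [f]
    is extended to [Y] by a [k]-linear retraction [r] of [g], and [h y] maps [a] to
    [l (r (a y))]. *)
Lemma injective_dual_regular : injective_module (dual_regular A).
Proof.
apply/injective_moduleP => X Y g f Xfd [n dimY] g_inj.
have [r rK] := linear_retraction (f := restrict_lin g) g_inj dimY.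
have l_lin : linear (fun x : restrict X => dapp (f x) 1).
  move=> c x y; rewrite -[_ *: x]/(alg_map A c *: (x : X)) linearP.
  rewrite -[LHS]/(dapp (alg_map A c *: f x) 1 + dapp (f y) 1).
  by rewrite dappZk.
pose l : {linear restrict X -> k^o} := lin_of l_lin.
have h_lin (y : Y) : linear (fun a : restrict A^o => l (r ((a : A) *: y : Y))).
  move=> c a b; rewrite -!linearP; congr (l (r _)).
  by rewrite scalerDl -scalerA.
pose h (y : Y) : dual_regular A := lin_of (h_lin y).
have hE y a : dapp (h y) a = l (r ((a : A) *: y : Y)) by [].
have hlin : linear h.
  move=> a x y; apply: hom_ext => b; rewrite -[LHS]/(dapp (h _) b).
  rewrite -[RHS]/(dapp (a *: h x) b + dapp (h y) b) dappZ !hE -!linearD.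
  by rewrite scalerDr scalerA.
exists (lin_of hlin) => x; apply: hom_ext => a.
rewrite -[LHS]/(dapp (h (g x)) a) hE -linearZ.
rewrite -[g _]/(restrict_lin g (a *: x)) rK /l /= linearZ dappZ mul1r.
by [].
Qed.

Lemma finite_dim_dual_regular : finite_dim A^o -> finite_dim (dual_regular A).
Proof.
move=> [n dimA]; have [c [u [cu _]]] := has_dim_basis dimA.
have f_lin : linear (fun f : restrict (dual_regular A) => \row_i dapp f (u i)).
  move=> a f g; apply/rowP => i; rewrite !mxE.
  by rewrite -[LHS]/(dapp (alg_map A a *: (f : dual_regular A)) (u i) + dapp g
    (u i)) dappZk.
have f_inj : injective (lin_of f_lin).
  move=> f g /rowP fg; apply: hom_ext => x; rewrite [x]cu.
  rewrite -[LHS]/(dapp f _) -[RHS]/(dapp g _) !linear_sum;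
    apply: eq_bigr => i _.
  by rewrite !linearZ; have := fg i; rewrite !mxE => ->.
by have [m [? _ _]] := has_dim_inj f_inj (has_dim_row _ _); exists m.
Qed.

(** Each coordinate [c i] induces [x |-> (a |-> c i (a x))] from [X] to [D(A)]; the values at
    [a = 1] recover the coordinates of [x]. *)
Lemma embed_injective X : finite_dim A^o -> finite_dim X ->
  exists Q (f : {linear X -> Q}), [/\ finite_dim Q,
    injective_module Q & injective f].
Proof.
move=> Afd [n dimX]; have [c [u [cu _]]] := has_dim_basis dimX.
have f_lin i (x : X) : linear (fun a : restrict A^o => c i ((a : A) *: x : X)).
  move=> b a a'; rewrite -linearP; congr (c i _).
  by rewrite scalerDl -scalerA.
pose f i (x : X) : dual_regular A := lin_of (f_lin i x).
have flin : linear (fun x => [ffun i => f i x]).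
  move=> a x y; apply/ffunP => i; rewrite !ffunE; apply: hom_ext => b.
  rewrite -[LHS]/(c i (b *: (a *: x + y) : X)).
  rewrite -[RHS]/(c i ((b * a) *: x : X) + c i (b *: y : X)).
  by rewrite -linearD scalerDr scalerA.
exists {ffun 'I_n -> dual_regular A}, (lin_of flin); split.
- exact/finite_dim_ffun/finite_dim_dual_regular.
- exact/injective_ffun/injective_dual_regular.
move=> x y /ffunP xy; rewrite [x]cu [y]cu; apply: eq_bigr => i _;
  congr (_ *: _).
have fE z : dapp (f i z) 1 = c i z by rewrite -[LHS]/(c i ((1 : A) *: z))
  scale1r.
by have := xy i; rewrite !ffunE -!fE => ->.
Qed.

(* The envelope is the image of an idempotent [e] of [Q] that fixes [X] and has
   the smallest image. A nonzero submodule [T] of it meeting [X] trivially would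
   give, by injectivity, an endomorphism fixing [X] and killing [T], and its
   Fitting idempotent would have a smaller image. *)
Lemma injective_envelope X Q (i : {linear X -> Q}) :
  finite_dim X -> finite_dim Q -> injective_module Q -> injective i ->
  exists I (j : {linear X -> I}),
    [/\ finite_dim I, injective_module I, injective j, essential (range j)
      & projective_module Q -> projective_module I].
Proof.
move=> Xfd Qfd injQ i_inj.
pose P (S : submodule Q) := exists e : End_alg Q, let e' := e :
  {linear Q -> Q} in
  [/\ e * e = e, forall x, e' (i x) = i x & forall x, S x <-> e' x = x].
have [S [[e [ee ei Se]] Smin]] : exists S, P S /\ forall S' :
  submodule Q, P S' ->
    (forall x, S' x -> S x) -> forall x, S x -> S' x.
  apply: (@minimal_submodule _ A Q P) => //.
  exists (lin_im (idfun : {linear Q -> Q})), 1; split; rewrite ?mulr1//.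
  by move=> x; split=> // _; exists x.
set e' := (e : {linear Q -> Q}) in ei Se.
have ee' x : e' (e' x) = e' x by rewrite
  -[in RHS](congr1 (fun f : End_alg Q => (f : {linear Q -> Q}) x) ee).
have iS x : S (i x) by apply/Se.
have eS x : S (e' x) by apply/Se.
pose j := corestrict iS; pose r := corestrict eS.
have rK : cancel (subval S) r.
  by move=> x; apply: (@subval_inj _ _ S); rewrite corestrictE;
    apply/Se/subvalP.
have j_inj : injective j.
  by move=> x y /(congr1 (subval _)); rewrite !corestrictE => /i_inj.
have retr (x : sub S) : x = \sum_(l < 1) r (subval S x).
  by rewrite big_ord1 rK.
exists (sub S), j; split=> //.
- exact: finite_dim_sub.
- by apply: (@injective_of_retract (sub S) 'I_1 (fun=> Q) (fun=> subval S)
  (fun=> r)).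
- move=> T T_closed jT; apply/seteqP; split=> [t /= Tt|_ ->];
  last by have [] := T_closed.
  have [T0 Tlin] := T_closed.
  pose T' : submodule (sub S) := Submodule T0 Tlin.
  pose f : {linear (X * sub T')%type -> Q} := i \o fstl X (sub T').
  pose w : {linear (X * sub T')%type -> Q} :=
    f \+ (subval S \o (subval T' \o sndl X (sub T'))).
  have wE x z : w (x, z) = i x + subval S (subval T' z) by [].
  have w_inj : injective w.
    suff w0 y : w y = 0 -> y = 0.
      by move=> y z yz; apply/eqP; rewrite -subr_eq0; apply/eqP/w0;
        rewrite linearB yz subrr.
    case: y => x z; rewrite wE => /eqP; rewrite addr_eq0 -linearN => /eqP izx.
    have jx : j x = - subval T' z.
      by apply: (@subval_inj _ _ S); rewrite corestrictE izx.
    have jx0 : j x = 0.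
      suff : (range j `&` [set` T]) (j x) by rewrite jT.
      split; first by exists x.
      by rewrite jx -linearN; apply: (subvalP (S := T') (- z)).
    congr pair; first by apply: j_inj; rewrite jx0 linear0.
    apply: (@subval_inj _ _ T'); apply: oppr_inj.
    by rewrite -jx jx0 linear0 ?oppr0.
  have [h hE] := (injective_moduleP Q).1 injQ _ _ w f
    (finite_dim_prod Xfd (finite_dim_sub T' (finite_dim_sub S Qfd))) Qfd w_inj.
  have hi x : h (i x) = i x.
    by have := hE (x, 0); rewrite wE !linear0 addr0.
  have ht : h (subval S t) = 0.
    have := hE (0, insub_mod (S := T') Tt);
      rewrite wE insub_modK linear0 add0r => ->.
    exact: linear0.
  (* The factors [e] ensure [e p = p] for the Fitting idempotent [p], so that its image lies in [S]
     and minimality of [S] applies. *)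
  pose g : End_alg Q := e * (h : End_alg Q) * e.
  have [N [u [gu gp pp]]] := fitting (finite_dim_End Qfd) g.
  set p := g ^+ N.+1 * u in gp pp.
  have pE : p = u * g ^+ N.+1 by apply/commr_sym/commrX/commr_sym.
  pose V : lmodType (End_alg Q) := evaluation Q.
  have gi x : g *: (i x : V) = i x.
    by rewrite -[LHS]/(e' (h (e' (i x)))) ei hi ei.
  have gni x n : g ^+ n *: (i x : V) = i x.
    by elim: n => [|n IHn]; rewrite ?scale1r// exprS -scalerA IHn gi.
  have gt : g *: (subval S t : V) = 0.
    by rewrite -[LHS]/(e' (h (e' (subval S t)))) ((Se _).1 (subvalP t)) ht
      linear0.
  have St : lin_im (p : {linear Q -> Q}) (subval S t).
    apply: Smin (subvalP t) => [|_ [y <-]].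
      exists p; split=> // [x|x].
        rewrite -[LHS]/(p *: (i x : V)) -(gni x N.+1) scalerA.
        by rewrite /p -mulrA -pE gp.
      split=> [[y <-]|px]; last by exists x.
      by rewrite -[LHS]/((p * p : End_alg Q) *: (y : V)) pp.
    apply/Se; rewrite -[LHS]/((e * p : End_alg Q) *: (y : V)).
    by rewrite /p exprS /g !mulrA ee.
  apply: (@subval_inj _ _ S); rewrite linear0.
  have pt : p *: (subval S t : V) = 0
    by rewrite pE exprSr -scalerA -scalerA gt !scaler0.
  have [y yE] := St; rewrite -pt -yE.
  by rewrite -[RHS]/((p * p : End_alg Q) *: (y : V)) pp.
by move=> projQ; apply: (@projective_of_retract _ _ (sub S) 'I_1 (fun=> Q)
  (fun=> subval S) (fun=> r)).
Qed.

End Injective.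

(** * Dominant dimension *)

Section Evaluation.
Variables (k : fieldType) (A : algebra k) (T : lmodType A).
Hypothesis Tfd : finite_dim T.
Local Notation E := (End_alg T).
Local Notation V := (evaluation T).

(** [T] is [Hom(A, T)]: with [ev i t] the endomorphism [s |-> b i s *: t], the element [t] is the
    sum of the [ev i t] applied to [a i 1], so the [a i 1] generate and it suffices to lift their
    images. *)
Lemma projective_evaluation : sum_retract T A^o -> projective_module V.
Proof.
move=> [I [a [b ab]]]; apply/projective_moduleP => X Y g f _ _ g_surj.
have /choice[x xE] i : exists x, g x = f (a i 1 : V) by apply: g_surj.
have ev_lin i (t : T) : linear (fun s : T => (b i s : A) *: t).
  by move=> c s s'; rewrite linearP scalerDl -scalerA.
pose ev i t : E := lin_of (ev_lin i t).
have h_lin : linear (fun t : V => \sum_i ev i t *: x i).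
  move=> c t t'; rewrite scaler_sumr -big_split; apply: eq_bigr => i _ /=.
  rewrite scalerA -scalerDl; congr (_ *: _); apply: hom_ext => s.
  rewrite -[LHS]/((b i s : A) *: ((c : {linear T -> T}) t + t' : T)).
  rewrite -[RHS]/((c : {linear T -> T}) ((b i s : A) *: (t : T)) +
    (b i s : A) *: (t' : T)).
  by rewrite linearZ scalerDr.
exists (lin_of h_lin) => t; rewrite /= linear_sum.
transitivity (f (\sum_i ev i t *: (a i 1 : V))).
  by rewrite linear_sum; apply: eq_bigr => i _; rewrite !linearZ xE.
congr (f _); transitivity (\sum_i (b i (a i 1) : A) *: (t : T)); first by [].
by rewrite -scaler_suml -(ab 1) scale1r.
Qed.

(* [Hom(T, D(A))] is the dual of [T] as a vector space; [Phi] defines an element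
   of its dual, which is evaluation at a unique [h0 y] in [T]. *)
Lemma injective_evaluation : sum_retract T (dual_regular A) ->
  injective_module V.
Proof.
move=> [I [a [b ab]]]; apply/injective_moduleP => X Y g f Xfd [d dimY] g_inj.
have [r rK] := linear_retraction (f := restrict_lin g) g_inj dimY.
have [n dimT] := Tfd; have [l [u [lu ul]]] := has_dim_basis dimT.
have l_ext (s t : T) : (forall j, l j s = l j t) -> s = t.
  by move=> st; rewrite [s]lu [t]lu; apply: eq_bigr => j _; rewrite st.
(* [c j] is the map [T -> D(A)] corresponding to the coordinate [l j]; the [c j] span [Hom(T, D(A))]
   over [k], which reduces [key] to coordinates. *)
have c_lin j (t : T) : linear (fun x : restrict A^o => l j ((x : A) *: t : T)).
  by move=> z x y; rewrite -linearP; congr (l j _); rewrite scalerDl -scalerA.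
pose cfun j (t : T) : dual_regular A := lin_of (c_lin j t).
have cfun_lin j : linear (cfun j).
  move=> x s t; apply: hom_ext => y; rewrite
    -[LHS]/(l j ((y : A) *: (x *: s + t) : T)).
  rewrite -[RHS]/(l j (((y : A) * x) *: s : T) + l j ((y : A) *: t : T)).
  by rewrite -linearD scalerDr scalerA.
pose c j : {linear T -> dual_regular A} := lin_of (cfun_lin j).
have c1 j t : dapp (c j t) 1 = l j t by rewrite -[LHS]/(l j ((1 : A) *: t : T))
  scale1r.
have mu_lin i : linear (fun y : restrict Y => dapp (b i (f (r y) : T)) 1).
  move=> z x y; rewrite linearP.
  rewrite -[_ *: r x]/(alg_map E z *: (r x : X)) linearP.
  rewrite -[alg_map E z *: _ + _]/(alg_map A z *: (f (r x) : T) +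
    (f (r y) : T)).
  rewrite linearP -[LHS]/(dapp (alg_map A z *: b i (f (r x) : T)) 1 + dapp
    (b i (f (r y) : T)) 1).
  by rewrite dappZk.
pose mu i : {linear restrict Y -> k^o} := lin_of (mu_lin i).
pose act i (q : {linear T -> dual_regular A}) (y : Y) : restrict Y :=
  (a i \o q : E) *: y.
pose Phi (q : {linear T -> dual_regular A}) y := \sum_i mu i (act i q y).
pose h0 (y : Y) : restrict T := \sum_j (Phi (c j) y : k) *: u j.
have key (q : {linear T -> dual_regular A}) (y : Y) :
  dapp (q (h0 y : T)) 1 = Phi q y.
  pose gam j : k := dapp (q (u j)) 1.
  have q_lin : linear (fun t : restrict T => dapp (q t) 1).
    move=> z s t; rewrite -[_ *: s]/(alg_map A z *: (s : T)) linearP.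
    by rewrite -[LHS]/(dapp (alg_map A z *: q s) 1 + dapp (q t) 1) dappZk.
  have qE t : q t = \sum_j alg_map A (gam j) *: c j t.
    apply: hom_ext => x; rewrite -[RHS]/(dapp _ x) dapp_sum
      -[LHS]/(dapp (q t) x).
    rewrite -[x]mul1r -dappZ -linearZ.
    rewrite -[LHS]/(lin_of q_lin ((x : A) *: t)) [in LHS](lu ((x : A) *: t))
      linear_sum.
    apply: eq_bigr => j _; rewrite linearZ
      -[RHS]/(dapp (alg_map A (gam j) *: c j t) (1 * x)).
    by rewrite dappZk mul1r mulrC.
  rewrite -[LHS]/(lin_of q_lin (h0 y)) linear_sum /Phi.
  transitivity (\sum_i \sum_j gam j * mu i (act i (c j) y)).
    rewrite exchange_big; apply: eq_bigr => j _;
      rewrite linearZ -[LHS]/((Phi (c j) y : k) * gam j) mulrC -mulr_sumr.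
    by [].
  apply: eq_bigr => i _.
  have -> : act i q y = \sum_j gam j *: act i (c j) y.
    transitivity ((\sum_j (alg_map E (gam j) * (a i \o c j : E))) *: y).
      apply: (congr1 (fun e : E => e *: y)); apply: hom_ext => t;
        rewrite hom_sumE.
      rewrite -[LHS]/(a i (q t)) qE linear_sum; apply: eq_bigr => j _.
      by rewrite linearZ.
    by rewrite scaler_suml; apply: eq_bigr => j _; rewrite -scalerA.
  by rewrite linear_sum; apply: eq_bigr => j _; rewrite linearZ.
have lh j y : l j (h0 y) = Phi (c j) y by rewrite ul.
have PhiD q y y' : Phi q (y + y') = Phi q y + Phi q y'.
  rewrite /Phi -big_split; apply: eq_bigr => i _;
    rewrite /= -[RHS](linearD (mu i)); congr (mu i _).
  exact: (scalerDr (a i \o q : E) y y').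
have PhiZ q (e : E) y : Phi q (e *: y) = Phi (q \o (e : {linear T -> T})) y.
  apply: eq_bigr => i _; congr (mu i _); rewrite /act scalerA.
  by apply: (congr1 (fun e : E => e *: y)); apply: hom_ext.
have h_lin : linear (h0 : Y -> V).
  move=> e y y'; apply: l_ext => j; rewrite lh PhiD PhiZ -!key.
  rewrite -[dapp ((c j \o _) _) 1]/(dapp (c j ((e : {linear T -> T}) (h0 y))) 1)
    !c1.
  by rewrite -linearD.
exists (lin_of h_lin) => x; apply: l_ext => j;
  rewrite /= lh -[RHS]c1 [c j (f x)]ab.
rewrite dapp_sum; apply: eq_bigr => i _.
rewrite -[RHS]/(dapp (b i ((a i \o c j : E) *: f x : T)) 1) -linearZ.
rewrite /act -linearZ.
by rewrite -[LHS]/(dapp (b i (f (r (restrict_lin g ((a i \o c j : E) *: x))) :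
  T)) 1) rK.
Qed.

(* [{ffun 'I_n -> T}] is [Hom_k(T, T)] in terms of a basis [u] of [T], and [d]
   measures the failure of commuting with a basis [v] of [A]. *)
Lemma evaluation_copresentation : finite_dim A^o ->
  exists (m n : nat) (i : {linear E^o -> {ffun 'I_n -> V}})
         (d : {linear {ffun 'I_n -> V} -> {ffun 'I_m * 'I_n -> V}}),
    injective i /\ forall s, d s = 0 <-> exists e, i e = s.
Proof.
move=> [m dimA]; have [la [v [lav _]]] := has_dim_basis dimA.
have [n dimT] := Tfd; have [l [u [lu _]]] := has_dim_basis dimT.
have i_lin : linear (fun e : E^o => [ffun j => (e : E) *: (u j : V)]).
  by move=> c x y; apply/ffunP => j; rewrite !ffunE scalerDl scalerA.
pose L (s : {ffun 'I_n -> V}) (t : T) : T :=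
  \sum_j alg_map A (l j t) *: (s j : T).
have Llin s : linear (L s : restrict T -> restrict T).
  move=> c x y; rewrite /L scaler_sumr -big_split; apply: eq_bigr => j _ /=.
  rewrite linearP rmorphD scalerDl; congr (_ + _).
  by rewrite -[RHS]/(alg_map A c *: (alg_map A (l j x) *: (s j : T))) scalerA
    -rmorphM.
pose d0 (s : {ffun 'I_n -> V}) (p : 'I_m * 'I_n) : V :=
  L s ((v p.1 : A) *: (u p.2 : T)) - (v p.1 : A) *: (s p.2 : T).
have LE (e : E) s t : L (e *: s) t = (e : {linear T -> T}) (L s t).
  rewrite /L linear_sum; apply: eq_bigr => j _; rewrite ffunE linearZ.
  by [].
have LD s s' t : L (s + s') t = L s t + L s' t.
  by rewrite /L -big_split; apply: eq_bigr => j _; rewrite ffunE scalerDr.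
have d_lin : linear (fun s => [ffun p => d0 s p]).
  move=> e s s'; apply/ffunP => p; rewrite !ffunE /d0 LD LE.
  rewrite -[X in _ = X + _]/((e : {linear T -> T})
    (L s _ - (v p.1 : A) *: (s p.2 : T))).
  have -> : (e *: s + s') p.2 = (e : {linear T -> T}) (s p.2) + (s' p.2 : T).
    by rewrite !ffunE.
  by rewrite scalerDr linearB (linearZZ (e : {linear T -> T})) opprD addrACA.
exists m, n, (lin_of i_lin), (lin_of d_lin); split=> [e e' /ffunP ee'|s].
  apply: hom_ext => t; rewrite [t]lu.
  have ee'' j : (e : {linear T -> T}) (u j) = (e' : {linear T -> T}) (u j).
    by have := ee' j; rewrite !ffunE.
  rewrite -!/(restrict_lin (_ : {linear T -> T}) _) !linear_sum.
  by apply: eq_bigr => j _; rewrite !linearZ; congr (_ *: _); apply: ee''.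
split=> [/ffunP ds|[e <-]]; last first.
  apply/ffunP => p; rewrite !ffunE /d0.
  have LiE t : L [ffun j => (e : E) *: (u j : V)] t = (e : {linear T -> T}) t.
    rewrite [in RHS](lu t) -[RHS]/(restrict_lin (e : {linear T -> T}) _)
      linear_sum.
    by apply: eq_bigr => j _; rewrite linearZ ffunE.
  by rewrite /= LiE linearZ ffunE subrr.
have dsE q p : L s ((v q : A) *: (u p : T)) = (v q : A) *: (s p : T).
  by have /eqP := ds (q, p); rewrite !ffunE subr_eq0 => /eqP.
pose Lk : {linear restrict T -> restrict T} := lin_of (Llin s).
have Lu (a : A) p : L s (a *: (u p : T)) = a *: (s p : T).
  have act_lin (t : T) : linear (fun b : restrict A^o => (b : A) *: t :
    restrict T).
    by move=> c x y; rewrite scalerDl -scalerA.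
  rewrite -[LHS]/(Lk (lin_of (act_lin (u p)) a))
    -[RHS]/(lin_of (act_lin (s p)) a).
  rewrite [a in LHS](lav a) [a in RHS](lav a) !linear_sum;
    apply: eq_bigr => q _.
  by rewrite !linearZ; congr (_ *: _); apply: dsE.
have LsE (a : A) (t : T) : L s (a *: t) = a *: L s t.
  rewrite [t in LHS](lu t) -[LHS]/(Lk _) /L.
  rewrite -[\sum_j l j t *: u j]/(\sum_j alg_map A (l j t) *: (u j : T)).
  rewrite scaler_sumr -[LHS]/(Lk (\sum_j
    (a *: (alg_map A (l j t) *: (u j : T)) : restrict T))).
  rewrite linear_sum scaler_sumr; apply: eq_bigr => j _.
  by rewrite !scalerA; apply: Lu.
have Ls_lin : linear (L s : T -> T).
  move=> a x y; rewrite -LsE; exact: (linearD Lk).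
exists (lin_of Ls_lin : {linear T -> T}); apply/ffunP => p; rewrite ffunE.
by have := Lu 1 p; rewrite !scale1r.
Qed.

End Evaluation.

(** * Minimal injective resolutions from iterated envelopes *)

Section Resolution.
Variables (k : fieldType) (B : algebra k).
Hypothesis Bfd : finite_dim B^o.

Definition embeds_proj_inj (X : lmodType B) : Prop :=
  exists (Q : lmodType B) (f : {linear X -> Q}),
    [/\ finite_dim Q, injective_module Q, projective_module Q & injective f].

(** Bundling the finiteness proof lets the cosyzygy be iterated by a fixpoint. *)
Record fdmod := FdMod { fdmod_sort : lmodType B;
  fdmodP : finite_dim fdmod_sort }.

(** The envelope is cut out of a projective-injective module whenever [X] embeds in one, and is then
    projective as a summand of it. *)
Lemma envelope_exists (X : fdmod) : exists (I : lmodType B),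
  exists j : {linear fdmod_sort X -> I},
    [/\ finite_dim I, injective_module I, injective j, essential (range j)
      & embeds_proj_inj (fdmod_sort X) -> projective_module I].
Proof.
have Xfd := fdmodP X.
have [[Q [f [Qfd injQ projQ f_inj]]]|N] :=
  pselect (embeds_proj_inj (fdmod_sort X)).
  have [I [j [? ? ? ? projI]]] := injective_envelope Xfd Qfd injQ f_inj.
  by exists I, j; split=> // _; apply: projI.
have [Q [f [Qfd injQ f_inj]]] := embed_injective Bfd Xfd.
have [I [j [? ? ? ? _]]] := injective_envelope Xfd Qfd injQ f_inj.
by exists I, j; split.
Qed.

Definition envelope (X : fdmod) : lmodType B := sval (cid (envelope_exists X)).
Definition envelope_map (X : fdmod) : {linear fdmod_sort X -> envelope X} :=
  sval (cid (svalP (cid (envelope_exists X)))).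

Lemma envelopeP X :
  [/\ finite_dim (envelope X), injective_module (envelope X),
      injective (envelope_map X), essential (range (envelope_map X))
    & embeds_proj_inj (fdmod_sort X) -> projective_module (envelope X)].
Proof. exact: (svalP (cid (svalP (cid (envelope_exists X))))). Qed.

Lemma finite_dim_envelope X : finite_dim (envelope X).
Proof. by case: (envelopeP X). Qed.

Definition cosyzygy (X : fdmod) : fdmod :=
  FdMod (finite_dim_quot (lin_im (envelope_map X)) (finite_dim_envelope X)).

Definition coresolution_map (X : fdmod) :
    {linear envelope X -> envelope (cosyzygy X)} :=
  envelope_map (cosyzygy X) \o quot_proj (lin_im (envelope_map X)).

Lemma coresolution_map_exact X :
  range (envelope_map X) = mod_ker (coresolution_map X).
Proof.
have [_ _ j_inj _ _] := envelopeP (cosyzygy X).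
apply/seteqP; split=> [_ [x _ <-]|y].
  have jx0 : quot_proj (lin_im (envelope_map X)) (envelope_map X x) = 0.
    by apply/quot_proj_eq0; exists x.
  exact: (etrans (congr1 (envelope_map (cosyzygy X)) jx0) (linear0 _)).
move=> dy; have /j_inj/quot_proj_eq0[x <-] :=
  etrans dy (esym (linear0 (envelope_map (cosyzygy X)))).
by exists x.
Qed.

Lemma range_coresolution_map X :
  range (coresolution_map X) = range (envelope_map (cosyzygy X)).
Proof.
apply/seteqP; split=> [_ [x _ <-]|_ [y _ <-]]; first by exists (quot_proj _ x).
by have [x <-] := quot_proj_surj y; exists x.
Qed.

Fixpoint cosyzygies (X : fdmod) (n : nat) : fdmod :=
  if n is n'.+1 then cosyzygy (cosyzygies X n') else X.

Lemma minimal_injective_resolutionP (X : fdmod) :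
  @minimal_injective_resolution _ _ (fdmod_sort X)
    (fun n => envelope (cosyzygies X n)) (envelope_map X)
    (fun n => coresolution_map (cosyzygies X n)).
Proof.
split.
- by move=> i; case: (envelopeP (cosyzygies X i)).
- by split; [case: (envelopeP X)|apply: coresolution_map_exact].
- by move=> i; rewrite range_coresolution_map; apply: coresolution_map_exact.
split; first by case: (envelopeP X).
by move=> i; rewrite range_coresolution_map;
  case: (envelopeP (cosyzygies X i.+1)).
Qed.

(** Injectivity of [Q0] extends [i] to a map [h] on the envelope, and essentiality makes [h]
    injective. The kernel of [d \o h] is then the image of [X], so the cosyzygy embeds in [Q1]. *)
Lemma embeds_proj_inj_cosyzygy (X : fdmod) (Q0 Q1 : lmodType B)
    (i : {linear fdmod_sort X -> Q0}) (d : {linear Q0 -> Q1}) :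
  finite_dim Q0 -> injective_module Q0 ->
  finite_dim Q1 -> injective_module Q1 -> projective_module Q1 ->
  injective i -> (forall s, d s = 0 <-> exists x, i x = s) ->
  embeds_proj_inj (fdmod_sort (cosyzygy X)).
Proof.
move=> Q0fd injQ0 Q1fd injQ1 projQ1 i_inj id_exact.
have [Ifd injI j_inj j_ess _] := envelopeP X.
have [h hE] := (injective_moduleP Q0).1 injQ0 _ _ (envelope_map X) i (fdmodP X)
  Ifd j_inj.
have h0 y : h y = 0 -> y = 0.
  move=> hy; pose T := submodule_pred (lin_ker h).
  have : [set` T] = [set 0].
    apply: j_ess; first exact: submodule_pred_closed.
    apply/seteqP; split=> [_ [[x _ <-] /submodule_predP/= hx]|_ ->]; last first.
      by split; [exists 0; rewrite ?linear0|apply/submodule_predP/linear0].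
    by rewrite hE -(linear0 i) in hx; rewrite (i_inj _ _ hx) linear0.
  by move/seteqP => [T0 _]; apply: T0; apply/submodule_predP.
have dh0 y : lin_im (envelope_map X) y -> (d \o h) y = 0.
  by move=> [x <-]; rewrite /= hE; apply/id_exact; exists x.
exists Q1, (quot_lift dh0); split=> //.
suff f0 y : quot_lift dh0 y = 0 -> y = 0.
  by move=> x y xy; apply/eqP; rewrite -subr_eq0; apply/eqP/f0;
    rewrite linearB xy subrr.
have [x <-] := quot_proj_surj y; rewrite quot_liftE => /id_exact[z zE].
apply/quot_proj_eq0; exists z; apply/eqP; rewrite -subr_eq0; apply/eqP/h0.
by rewrite linearB hE zE subrr.
Qed.

Lemma minimal_resolution_proj_inj (Q0 Q1 : lmodType B)
    (i : {linear B^o -> Q0}) (d : {linear Q0 -> Q1}) :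
  finite_dim Q0 -> injective_module Q0 -> projective_module Q0 ->
  finite_dim Q1 -> injective_module Q1 -> projective_module Q1 ->
  injective i -> (forall s, d s = 0 <-> exists x, i x = s) ->
  exists (I : nat -> lmodType B) (e : {linear B^o -> I 0%N})
         (d : forall i, {linear I i -> I i.+1}),
    minimal_injective_resolution e d /\
    forall i, (i < 2)%N -> projective_module (I i).
Proof.
move=> Q0fd injQ0 projQ0 Q1fd injQ1 projQ1 i_inj id_exact.
pose X := FdMod Bfd; exists (fun n => envelope (cosyzygies X n)),
  (envelope_map X).
exists (fun n => coresolution_map (cosyzygies X n)); split.
  exact: minimal_injective_resolutionP.
move=> [|[|//]] _.
  by have [_ _ _ _] := envelopeP X; apply; exists Q0, i.
have [_ _ _ _] := envelopeP (cosyzygy X); apply.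
exact: (embeds_proj_inj_cosyzygy (X := X) Q0fd injQ0 Q1fd injQ1 projQ1 i_inj
  id_exact).
Qed.

End Resolution.

(** * Suprema and infima of extended integers *)

Section ExtendedIntegers.
Local Open Scope ereal_scope.
Implicit Types (S : set (\bar int)) (x : \bar int).

(** [supremum] is a chosen element of [supremums], meaningful only if one exists. Below an integer
    bound [n], the least distance [d] to a member gives a maximum; if no member is finite, the
    supremum is [-oo]; with no integer bound it is [+oo]. *)
Lemma ereal_int_supremums_neq0 S : supremums S !=set0.
Proof.
have [[n Sn]|N] := pselect (exists n : int, ubound S n%:E); last first.
  exists +oo; split=> [x _|y Sy]; first exact: leey.
  case: y Sy => [n Sn|//|Sy]; first by case: N; exists n.
  by case: N; exists 0%R => x /Sy; rewrite leeNy_eq => /eqP ->; exact: leNye.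
have [[d0 Sd0]|N] := pselect (exists d : nat, S (n - d%:Z)%R%:E).
  have [d [Sd dmin]] := ex_minimal (ex_intro (fun d : nat => S (n - d%:Z)%R%:E)
    d0 Sd0).
  exists (n - d%:Z)%R%:E; split=> [x Sx|y]; last exact.
  have := Sn _ Sx; case: x Sx => [m Sm|//|_ _]; last exact: leNye.
  rewrite !lee_fin => lemn; have [e eE] : exists e : nat, (n - m = e%:Z)%R.
    by exists `|n - m|%N; rewrite gez0_abs// subr_ge0.
  have mE : m = (n - e%:Z)%R by rewrite -eE subKr.
  by rewrite mE lerD2l lerN2 lez_nat dmin// -mE.
exists -oo; split=> [x Sx|y _]; last exact: leNye.
have := Sn _ Sx; case: x Sx => [m Sm|//|//].
rewrite lee_fin => lemn; case: N; exists `|n - m|%N.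
by rewrite gez0_abs ?subr_ge0// subKr.
Qed.

Lemma le_supremum x0 S x : S x -> x <= supremum x0 S.
Proof. exact/ge_supremum_Nmem/ereal_int_supremums_neq0. Qed.

Lemma supremum_le x0 S x : x0 <= x -> ubound S x -> supremum x0 S <= x.
Proof.
move=> x0x Sx; rewrite /supremum; case: ifP => // _.
by case: xgetP => [y _ [_ Sy]|//]; apply: Sy.
Qed.

Lemma infimum_nat_le x0 (P : set nat) n :
  P n -> infimum x0 [set (n%:Z)%:E | n in P] <= n%:Z%:E.
Proof.
move=> Pn; apply: le_infimum_Nmem; last by exists n.
have [m [Pm m_min]] := ex_minimal (ex_intro P n Pn).
exists m%:Z%:E; split=> [_ [p Pp <-]|y]; last by apply; exists m.
by rewrite lee_fin lez_nat m_min.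
Qed.
End ExtendedIntegers.

(** * Projective dimension, global dimension and [add] in their official forms *)

Section Dimensions.
Variables (k : fieldType) (A : algebra k).
Implicit Types M X Y : lmodType A.

(** Pads finite resolutions to infinite ones. *)
Definition zero_module X : lmodType A :=
  sub (lin_ker (idfun : {linear X -> X})).

Lemma zero_module0 X (x : zero_module X) : x = 0.
Proof. by apply: (@subval_inj _ _ (lin_ker idfun)); rewrite linear0;
  apply: (subvalP x). Qed.

(** A resolution of the syzygy [K] is shifted by one and spliced to [P0] by [i \o e']. *)
Lemma pdim_le_resolution n X : pdim_le n X ->
  exists (P : nat -> lmodType A) (e : {linear P 0%N -> X})
         (d : forall i, {linear P i.+1 -> P i}),
    projective_resolution e d /\ forall i, (n < i)%N -> forall x : P i, x = 0.
Proof.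
elim: n X => [|n IHn] X.
  move=> [Xfd projX].
  pose P i : lmodType A := if i is _.+1 then zero_module X else X.
  exists P, idfun, (fun i => \0 : {linear P i.+1 -> P i}); split; last first.
    by case=> // i _ x; apply: zero_module0.
  split.
  - case=> [//|i]; split; first exact: finite_dim_sub.
    apply/projective_moduleP => Y Z g f _ _ _; exists \0 => x.
    by rewrite [x]zero_module0 !linear0.
  - split; first by apply/seteqP; split=> // x _; exists x.
    apply/seteqP; split=> x; last by exists 0 => //; exact: esym.
    by move=> [y _ <-]; apply: linear0.
  - move=> i; apply/seteqP; split=> x; first by move=> _; case: i x.
    by move=> _; exists 0 => //; exact: (esym (zero_module0 x)).
move=> [P0 [K [i [p [P0fd projP0 [i_inj ip p_surj] /IHn]]]]].
move=> [P' [e' [d' [[P'fd [e'T e'd'] d'd'] P'0]]]].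
pose P j : lmodType A := if j is j'.+1 then P' j' else P0.
pose d j : {linear P j.+1 -> P j} :=
  match j return {linear P j.+1 -> P j} with 0 => i \o e' | j'.+1 => d' j' end.
have e'_surj := (range_setT e').1 e'T.
exists P, p, d; split; last by case=> // j ltnj; apply: P'0.
split.
- by case.
- split; first exact/range_setT.
  apply/seteqP; split=> [_ [x _ <-]|x /ip[y <-]]; first by apply/ip;
    exists (e' x).
  by have [z <-] := e'_surj y; exists z.
case=> [|j]; last exact: d'd'.
rewrite /= e'd'; apply/seteqP; split=> x.
  by rewrite /mod_ker /= => ->; apply: linear0.
by move=> ix; apply: i_inj; rewrite linear0.
Qed.

Lemma proj_dim_le n X : pdim_le n X -> (proj_dim X <= n%:Z%:E)%E.
Proof. by move=> /pdim_le_resolution; apply: infimum_nat_le. Qed.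

Lemma gldim_lt_pinfty n : (forall X, finite_dim X -> pdim_le n X) ->
  (gldim A < +oo)%E.
Proof.
move=> pdn; apply: (@le_lt_trans _ _ n%:Z%:E); last exact: ltry.
apply: supremum_le; first by rewrite lee_fin.
by move=> _ [X [Xfd ->]]; apply/proj_dim_le/pdn.
Qed.

(** The complement is the kernel of the retraction [G] from the power of [M]. *)
Lemma sum_retract_in_add M X : sum_retract M X -> in_add M X.
Proof.
move=> [I [a [b ab]]].
have F_lin : linear (fun x => [ffun i : 'I_#|I| => a (enum_val i) x]).
  by move=> c x y; apply/ffunP => i; rewrite !ffunE linearP.
have G_lin : linear (fun s : {ffun 'I_#|I| -> M} =>
  \sum_i b (enum_val i) (s i)).
  move=> c s t; rewrite scaler_sumr -big_split; apply: eq_bigr => i _.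
  by rewrite !ffunE linearP.
pose F := lin_of F_lin; pose G := lin_of G_lin.
have FK : cancel F G.
  move=> x; rewrite [RHS]ab (reindex _ (onW_bij _ (@enum_val_bij I))) /=.
  by apply: eq_bigr => i _; rewrite ffunE.
exists #|I|, (sub (lin_ker G)).
pose f : {linear (X * sub (lin_ker G))%type -> {ffun 'I_#|I| -> M}} :=
  (F \o fstl X _) \+ (subval (lin_ker G) \o sndl X _).
have fE x y : f (x, y) = F x + subval _ y by [].
exists f; apply: inj_surj_bij => [[x y] [x' y']|s].
  rewrite !fE => xy; have := congr1 G xy.
  rewrite !linearD !FK [G (subval _ y)](subvalP y) [G (subval _ y')](subvalP y')
    !addr0 => xx'.
  by move: xy; rewrite xx' => /addrI/subval_inj ->.
have Gs : G (s - F (G s)) = 0 by rewrite linearB FK subrr.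
by exists (G s, insub_mod (S := lin_ker G) Gs);
  rewrite fE insub_modK addrC subrK.
Qed.

End Dimensions.

(** * The lower bound on rigidity dimension *)

Theorem corollary2p5 (k : fieldType) (A : algebra k)
    (Afd : finite_dim A^o) :
  (2%:Z%:E <= rigdim A)%E.
Proof.
have DAfd := finite_dim_dual_regular Afd.
(* Starting the tower at [A * D(A)] puts both factors in [add(T)], which makes [T] a
   generator-cogenerator. *)
have [T [towT addT _ Tfd]] := tower_exists (finite_dim_prod Afd DAfd).
have addA := sum_retract_trans addT (sum_retract_prodl _ _).
have addDA := sum_retract_trans addT (sum_retract_prodr _ _).
have [n pdn] := tower_gldim_finite Tfd towT.
apply: (@le_trans _ _ (domdim (End_alg T))); last first.
  apply: le_supremum; exists T; split=> //; last exact: gldim_lt_pinfty pdn.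
  by split; apply: sum_retract_in_add.
apply: le_supremum; exists 2%N => //.
(* The copresentation of [End(T)] by powers of the projective-injective module [T] controls exactly
   the terms [0] and [1] of the minimal resolution. *)
have [p [q [i [d [i_inj id_exact]]]]] := evaluation_copresentation Tfd Afd.
have Vfd := finite_dim_evaluation Tfd.
have projV := projective_evaluation addA.
have injV := injective_evaluation Tfd addDA.
apply: minimal_resolution_proj_inj i_inj id_exact;
  by [exact: finite_dim_End | exact: finite_dim_ffun | exact: injective_ffun |
    exact: projective_ffun].
Qed.
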